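(* For every integer $k\ge 0$, one has $Z^{\mathcal F,\mathrm{sh}}_k=Z_k$ as $\mathbb{Q}$-linear subspaces of $\mathbb{R}$.
   Context: An index is a finite (possibly empty) tuple $\mathbf{k}=(k_1,\ldots,k_n)$ of positive integers; $n$ is its depth and $|\mathbf{k}|=k_1+\cdots+k_n$ its weight. An index is admissible if it is empty or $k_n\ge 2$. For an admissible index, $\zeta(\mathbf{k})=\sum_{0<m_1<\cdots<m_n}\frac{1}{m_1^{k_1}\cdots m_n^{k_n}}$, with $\zeta(\emptyset)=1$. $Z_k\subset\mathbb{R}$ is the $\mathbb{Q}$-span of the $\zeta(\mathbf{k})$ with $\mathbf{k}$ admissible of weight $k$. Regularization with respect to the iterated integral expression (shuffle regularization): for any index $\mathbf{k}=(k_1,\ldots,k_n)$ there is a unique polynomial $P_{\mathbf{k}}(T)\in\mathbb{R}[T]$ such that, as $z\to 1^-$, $\sum_{0<m_1<\cdots<m_n}\frac{z^{m_n}}{m_1^{k_1}\cdots m_n^{k_n}}=P_{\mathbf{k}}(-\log(1-z))+o(1)$; one sets $\zeta^{\mathrm{reg},\mathrm{sh}}(\mathbf{k})=P_{\mathbf{k}}(0)$ (the constant term), and $\zeta^{\mathrm{reg},\mathrm{sh}}(\emptyset)=1$. For admissible $\mathbf{k}$ this is $\zeta(\mathbf{k})$. For any index $\mathbf{k}=(k_1,\ldots,k_n)$ put $$\zeta^{\mathcal F,\mathrm{sh}}(\mathbf{k})=\sum_{i=0}^n(-1)^{k_{i+1}+\cdots+k_n}\,\zeta^{\mathrm{reg},\mathrm{sh}}(k_1,\ldots,k_i)\,\zeta^{\mathrm{reg},\mathrm{sh}}(k_n,\ldots,k_{i+1}).$$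 $Z^{\mathcal F,\mathrm{sh}}_k$ is the $\mathbb{Q}$-vector space generated by $\{\zeta^{\mathcal F,\mathrm{sh}}(\mathbf{k}) : |\mathbf{k}|=k\}$. *)

(* Defs.v *)
From mathcomp Require Import all_boot all_order all_algebra.
From mathcomp Require Import all_classical all_reals all_analysis.

Set Implicit Arguments.
Unset Strict Implicit.
Unset Printing Implicit Defensive.

Import Order.TTheory GRing.Theory Num.Theory.
Import numFieldNormedType.Exports.
Local Open Scope classical_set_scope.
Local Open Scope ring_scope.

(* The index (k_1, ..., k_n) is the list [:: k_1; ...; k_n]. *)
Definition is_index (k : seq nat) : bool := all (fun j => 0 < j)%N k.

Definition depth (k : seq nat) : nat := size k.

Definition weight (k : seq nat) : nat := sumn k.

Definition admissible (k : seq nat) : bool :=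
  is_index k && ((k == [::]) || (2 <= last 0 k)%N).

Definition summation_range (n : nat) : set (seq nat) :=
  [set m | size m = n /\ path ltn 0%N m].

Section MultipleZetaValues.
Variable R : realType.

Definition mzv_term (k m : seq nat) : R :=
  \prod_(i < depth k) ((nth 0%N m i)%:R ^+ nth 0%N k i)^-1.

Definition zeta (k : seq nat) : R :=
  fine (\esum_(m in summation_range (depth k)) (mzv_term k m)%:E).

(* Only used for 0 < z < 1, where the terms are nonnegative, so that [esum] is
   the sum of the family. For the empty index the only term is 1. *)
Definition polylog (k : seq nat) (z : R) : R :=
  fine (\esum_(m in summation_range (depth k))
          (z ^+ last 0%N m * mzv_term k m)%:E).

Definition is_regularization_sh (k : seq nat) (P : {poly R}) : Prop :=
  polylog k z - P.[- ln (1 - z)] @[z --> 1^'-] --> (0 : R).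

(* [xget] selects the polynomial, which exists and is unique for any index;
   the default value 0 plays no role. *)
Definition regularization_sh (k : seq nat) : {poly R} :=
  xget 0 [set P | is_regularization_sh k P].

Definition zeta_reg_sh (k : seq nat) : R := (regularization_sh k).[0].

Definition zeta_F_sh (k : seq nat) : R :=
  \sum_(i < (depth k).+1)
    (-1) ^+ weight (drop i k)
    * zeta_reg_sh (take i k) * zeta_reg_sh (rev (drop i k)).

Definition Qspan (S : set R) : set R :=
  [set x | exists2 s : seq (rat * R),
     (forall p, p \in s -> S p.2) & x = \sum_(p <- s) ratr p.1 * p.2].

Definition Z_space (w : nat) : set R :=
  Qspan [set zeta k | k in [set k | admissible k /\ weight k = w]].

Definition Z_F_sh_space (w : nat) : set R :=
  Qspan [set zeta_F_sh k | k in [set k | is_index k /\ weight k = w]].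

End MultipleZetaValues.

Arguments Z_space R w : clear implicits.
Arguments Z_F_sh_space R w : clear implicits.

(* Main.v *)
(* Write multiple zeta values as integrals of words in x = dt/t and
   y = dt/(1-t). The inclusion of the finite space in the other one is clear
   from the definition, since regularized values are rational combinations of
   multiple zeta values of the same weight and products respect the weight.

   For the converse we argue by induction on the weight k, modulo X, the span of
   the finite values of weight k.

   Products: by Hoffman's relation between the two regularizations, the finite
   value differs from its stuffle analogue by terms c_n d, where d has weight
   k - n and, by Newton's identities, c_n lies in the ideal generated by the even
   zeta values. The stuffle product with a depth one index (2m) multiplies the
   finite value by 2 zeta(2m), so such terms lie in X by induction. As the
   stuffle analogue is multiplicative, X contains every product of two zeta
   values of positive weights with total weight k.

   Cyclic invariance: let g be the shuffle homomorphism extending the regularized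
   values by g(x) = g(y) = 0. Modulo products the finite value of an index gives
   zeta(rev) + (-1)^k zeta, and together with the antipode relation this says
   g(V y) = g(y V) modulo X. By duality also g(V x) = g(x V), so g is invariant
   under rotation modulo X. Let S be the sum of g(y U) over the rotations U of V.
   Expanding the product 0 = g(y) g(V) gives S + g(y V) = 0 modulo X; summing
   this over the rotations of V gives k S = 0, hence g(y V) = 0 modulo X. *)
Require Import Defs.
From mathcomp Require Import all_boot all_order all_algebra.
From mathcomp Require Import all_classical all_reals all_analysis.
From mathcomp Require Import ring lra zify.

Set Implicit Arguments.
Unset Strict Implicit.
Unset Printing Implicit Defensive.
Import Order.TTheory GRing.Theory Num.Theory.
Import numFieldNormedType.Exports.
Local Open Scope classical_set_scope.
Local Open Scope ring_scope.

(** * Quasi-shuffle products *)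

(** One identity is used for three letters y: the product of y with y^m v is (m+1) y^(m+1) v plus
    words with fewer leading y. The letter [true] regularizes polylogarithms as z tends to 1, the
    letter [0] truncated sums as N tends to infinity, and [false], on reversed words, extends the
    values to words ending in x. That extension is forced by the cyclic argument: rotations leave
    the set of words ending in y, so g has to be a homomorphism on all words. The analytic obstacle
    is that shuffle regularized values do not respect the stuffle product; what survives is
    multiplicativity when one factor is convergent. This comes from Abel summation, with errors that
    must beat every power of a logarithm; a spare factor sqrt n in the summability of the
    coefficients provides this. The comparison of the two regularizations is then algebra: a
    functional is determined by its values on the products of convergent v with 1^m, and the
    comparison series is the inverse of the one with coefficients [Zst (nseq n 0%N)]. The head of a
    word is the outermost integration, so indices enter reversed. *)

Section QuasiShuffle.
Variables (A : eqType) (op : A -> A -> option A).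

(** The partial contraction [op] lets one recursion cover the shuffle of words (always [None]) and
    the stuffle of indices (always [Some]). *)
Fixpoint qsh (u : seq A) : seq A -> seq (seq A) :=
  match u with
  | [::] => fun v => [:: v]
  | a :: u' => fix qsh_u v :=
      match v with
      | [::] => [:: a :: u']
      | b :: v' => [seq a :: w | w <- qsh u' (b :: v')]
                   ++ [seq b :: w | w <- qsh_u v']
                   ++ (if op a b is Some c then [seq c :: w | w <- qsh u' v']
                       else [::])
      end
  end.

Lemma qsh0s v : qsh [::] v = [:: v]. Proof. by []. Qed.

Lemma qshs0 u : qsh u [::] = [:: u]. Proof. by case: u. Qed.

Lemma qsh_cons a u b v :
  qsh (a :: u) (b :: v) =
  [seq a :: w | w <- qsh u (b :: v)] ++ [seq b :: w | w <- qsh (a :: u) v]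
  ++ (if op a b is Some c then [seq c :: w | w <- qsh u v] else [::]).
Proof. by []. Qed.

Variant qsh_spec (a : A) (u : seq A) (b : A) (v w : seq A) : Prop :=
  | QshL w' of w = a :: w' & w' \in qsh u (b :: v)
  | QshR w' of w = b :: w' & w' \in qsh (a :: u) v
  | QshM c w' of op a b = Some c & w = c :: w' & w' \in qsh u v.

Lemma mem_qsh a u b v w :
  w \in qsh (a :: u) (b :: v) -> qsh_spec a u b v w.
Proof.
rewrite qsh_cons !mem_cat => /orP[/mapP[w' ? ->]|/orP[/mapP[w' ? ->]|]].
- exact: QshL.
- exact: QshR.
- by case E: op => [c|//] /mapP[w' ? ->]; apply: QshM E _ _.
Qed.

Lemma size_ind2 (P : seq A -> seq A -> Prop) :
  (forall v, P [::] v) -> (forall u, P u [::]) ->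
  (forall a u b v, P u (b :: v) -> P (a :: u) v -> P u v ->
     P (a :: u) (b :: v)) -> forall u v, P u v.
Proof.
move=> P0s Ps0 Pc; elim=> [|a u IHu] // v; elim: v => [|b v IHv] //.
by apply: Pc.
Qed.

Section Sums.
Variable R : comNzRingType.
Implicit Types f g : seq A -> R.

Definition Qs f u v : R := \sum_(w <- qsh u v) f w.

(** [V] marks the subalgebra on which [f] is multiplicative; iterated integrals from 0 only make
    sense on part of the words. *)
Definition is_hom (V : pred (seq A)) f :=
  f [::] = 1 /\ forall u v, V u -> V v -> f u * f v = Qs f u v.

Lemma Qs0s f v : Qs f [::] v = f v. Proof. by rewrite /Qs big_seq1. Qed.

Lemma Qss0 f u : Qs f u [::] = f u.
Proof. by rewrite /Qs qshs0 big_seq1. Qed.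

Lemma Qs_cons f a u b v :
  Qs f (a :: u) (b :: v) =
  Qs (f \o cons a) u (b :: v) + Qs (f \o cons b) (a :: u) v
  + (if op a b is Some c then Qs (f \o cons c) u v else 0).
Proof.
rewrite /Qs qsh_cons !big_cat /= !big_map addrA; congr (_ + _).
by case: op => [c|]; rewrite ?big_map ?big_nil.
Qed.

Lemma eq_Qs f g u v : f =1 g -> Qs f u v = Qs g u v.
Proof. by move=> fg; apply: eq_bigr => w _. Qed.

Lemma eq_in_Qs f g u v : {in qsh u v, f =1 g} -> Qs f u v = Qs g u v.
Proof. by move=> fg; apply: eq_big_seq. Qed.

Lemma QsD f g u v : Qs (fun w => f w + g w) u v = Qs f u v + Qs g u v.
Proof. exact: big_split. Qed.

Lemma QsZ c f u v : Qs (fun w => c * f w) u v = c * Qs f u v.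
Proof. by rewrite /Qs mulr_sumr. Qed.

Lemma Qs_sum (I : Type) (r : seq I) (f : I -> seq A -> R) u v :
  Qs (fun w => \sum_(i <- r) f i w) u v = \sum_(i <- r) Qs (f i) u v.
Proof. by rewrite /Qs exchange_big. Qed.

Lemma Qs0 u v : Qs (fun=> 0) u v = 0.
Proof. exact: big1_eq. Qed.

Hypothesis opC : commutative op.

Lemma QsC f u v : Qs f u v = Qs f v u.
Proof.
move: u v f; apply: size_ind2 => [v f|u f|a u b v IH1 IH2 IH3 f].
- by rewrite Qs0s Qss0.
- by rewrite Qs0s Qss0.
rewrite !Qs_cons IH1 IH2 opC; congr (_ + _); first by rewrite addrC.
by case: op => // c; rewrite IH3.
Qed.

(** The recursion can equally be run from the last letters, which is why reversal respects the
    product. *)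
Lemma Qs_rcons f u a v b :
  Qs f (rcons u a) (rcons v b) =
  Qs (fun w => f (rcons w a)) u (rcons v b)
  + Qs (fun w => f (rcons w b)) (rcons u a) v
  + (if op a b is Some c then Qs (fun w => f (rcons w c)) u v else 0).
Proof.
move: u v f; apply: size_ind2 => [v f|u f|c u d v IH1 IH2 IH3 f].
- rewrite !Qs0s; elim: v f => [|d v IH] f /=.
    by rewrite Qs_cons /= !Qs0s !Qss0 /=; case: op => [c|]; rewrite ?Qs0s /=; ring.
  rewrite [in LHS]/= Qs_cons !Qs0s /= IH /= [in RHS]Qs_cons !Qs0s /=.
  case: (op a b) => [e|]; case: (op a d) => [e'|];
    rewrite ?Qs0s /= ?addr0 ?addrA; ring.
- rewrite !Qss0; elim: u f => [|d u IH] f /=.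
    by rewrite Qs_cons /= !Qs0s !Qss0 /=; case: op => [c|]; rewrite ?Qss0 /=; ring.
  rewrite Qs_cons !Qss0 /= IH /= !Qs_cons !Qss0 /=.
  case: (op a b) => [e|]; case: (op d b) => [e'|];
    rewrite ?Qss0 /= ?addr0 ?addrA; ring.
have E1 := Qs_cons (fun w => f (rcons w a)) c u d (rcons v b).
have E2 := Qs_cons (fun w => f (rcons w b)) c (rcons u a) d v.
rewrite !rcons_cons in IH1 IH2 *; rewrite E1 E2 Qs_cons IH1 IH2.
case E: (op a b) => [e|].
  rewrite (Qs_cons (fun w => f (rcons w e)) c u d v).
  by case E': (op c d) => [e'|]; rewrite ?IH3 ?E /comp /=; ring.
by case E': (op c d) => [e'|]; rewrite ?IH3 ?E /comp /=; ring.
Qed.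

Lemma Qs_rev f u v : Qs f (rev u) (rev v) = Qs (f \o rev) u v.
Proof.
move: u v f; apply: size_ind2 => [v f|u f|a u b v IH1 IH2 IH3 f].
- by rewrite !Qs0s.
- by rewrite !Qss0.
rewrite !rev_cons Qs_rcons -!rev_cons IH1 IH2 Qs_cons.
by congr (_ + _ + _); [..|case: op => // c; rewrite IH3];
  apply: eq_Qs => w /=; rewrite rev_cons.
Qed.

End Sums.
End QuasiShuffle.
Arguments qsh {A} op u v : simpl never.

(** * Deconcatenation and convolution of functionals *)

Section Convolution.
Variables (A : eqType) (op : A -> A -> option A) (R : comNzRingType).
Implicit Types f g : seq A -> R.
Local Notation Qs := (@Qs A op R).

(** The operation dual to deconcatenation. Finite values have this shape, and their stuffle analogue
    inherits multiplicativity from its two factors. *)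
Definition conv f g (w : seq A) : R :=
  \sum_(i < (size w).+1) f (take i w) * g (drop i w).

Lemma conv_nil f g : conv f g [::] = f [::] * g [::].
Proof. by rewrite /conv big_ord1. Qed.

Lemma conv_cons f g a w :
  conv f g (a :: w) = f [::] * g (a :: w) + conv (f \o cons a) g w.
Proof. by rewrite /conv big_ord_recl /=. Qed.

Lemma eq_conv f f' g g' : f =1 f' -> g =1 g' -> conv f g =1 conv f' g'.
Proof. by move=> ff' gg' w; apply: eq_bigr => i _; rewrite ff' gg'. Qed.

Lemma convDl f f' g w : conv (fun s => f s + f' s) g w = conv f g w + conv f' g w.
Proof. by rewrite -big_split; apply: eq_bigr => i _; rewrite mulrDl. Qed.

Lemma convZl c f g w : conv (fun s => c * f s) g w = c * conv f g w.
Proof. by rewrite /conv mulr_sumr; apply: eq_bigr => i _; rewrite mulrA. Qed.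

Lemma convA f g h w : conv (conv f g) h w = conv f (conv g h) w.
Proof.
elim: w f g => [|a w IH] f g; first by rewrite !conv_nil mulrA.
rewrite !conv_cons conv_nil mulrDr mulrA -!addrA; congr (_ + _).
rewrite (eq_conv (f' := fun s => f [::] * (g (a :: s)) + conv (f \o cons a) g s)
          (g' := h)) //; last by move=> s /=; rewrite conv_cons.
by rewrite convDl convZl IH.
Qed.

Lemma conv_rev f g w : conv f g (rev w) = conv (g \o rev) (f \o rev) w.
Proof.
rewrite /conv size_rev (reindex_inj rev_ord_inj) /=; apply: eq_bigr => i _.
by rewrite subSS take_rev drop_rev mulrC subKn // -ltnS.
Qed.

(** Deconcatenation is a homomorphism for the product: a cut of a product word cuts both factors.
    The cut with empty prefix is split off, and induction applies to the first letter of the other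
    prefixes. *)
Lemma Qs_conv f g u v :
  Qs (conv f g) u v =
  \sum_(i < (size u).+1) \sum_(j < (size v).+1)
     Qs f (take i u) (take j v) * Qs g (drop i u) (drop j v).
Proof.
move: u v f; apply: size_ind2 => [v f|u f|a u b v IH1 IH2 IH3 f].
- rewrite big_ord1 Qs0s; apply: eq_bigr => j _.
  by rewrite !Qs0s.
- rewrite Qss0; apply: eq_bigr => i _.
  by rewrite big_ord1 !Qss0.
pose F i j := Qs f (take i (a :: u)) (take j (b :: v))
              * Qs g (drop i (a :: u)) (drop j (b :: v)).
rewrite -/(\sum_(i < (size (a :: u)).+1) \sum_(j < (size (b :: v)).+1) F i j).
have step c u' v' : Qs (conv f g \o cons c) u' v' =
    f [::] * Qs (g \o cons c) u' v' + Qs (conv (f \o cons c) g) u' v'.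
  by rewrite -QsZ -QsD; apply: eq_Qs => w /=; rewrite conv_cons.
have -> : Qs (conv f g) (a :: u) (b :: v) =
    f [::] * Qs g (a :: u) (b :: v)
    + (Qs (conv (f \o cons a) g) u (b :: v) + Qs (conv (f \o cons b) g) (a :: u) v
       + (if op a b is Some c then Qs (conv (f \o cons c) g) u v else 0)).
  rewrite !Qs_cons !step; case: op => [c|]; rewrite ?step; ring.
rewrite IH1 IH2.
have -> : (if op a b is Some c then Qs (conv (f \o cons c) g) u v else 0) =
  \sum_(i < (size u).+1) \sum_(j < (size v).+1)
   (if op a b is Some c then Qs (f \o cons c) (take i u) (take j v) else 0)
     * Qs g (drop i u) (drop j v).
  case: op => [c|]; first by rewrite IH3.
  by rewrite big1 // => i _; rewrite big1 // => j _; rewrite mul0r.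
under eq_bigr do rewrite big_ord_recl.
rewrite big_split /= (big_ord_recl (size u).+1) /=.
under [in RHS]eq_bigr do rewrite big_ord_recl.
rewrite [in RHS]big_ord_recl /= [in RHS]big_split /=.
have -> : F 0%N 0%N = f [::] * Qs g (a :: u) (b :: v) by rewrite /F /= Qs0s.
have E1 : \sum_(i < (size u).+1) Qs (f \o cons a) (take i u) [::]
            * Qs g (drop i u) (b :: v) =
          \sum_(i < (size u).+1) F (bump 0 i) 0%N.
  by apply: eq_bigr => i _; rewrite /F /= !Qss0.
have E2 : \sum_(j < (size v).+1) Qs (f \o cons b) [::] (take j v)
            * Qs g (a :: u) (drop j v) =
          \sum_(j < (size v).+1) F 0%N (bump 0 j).
  by apply: eq_bigr => j _; rewrite /F /= !Qs0s.
have E3 : \sum_(i < (size u).+1) \sum_(j < (size v).+1) F (bump 0 i) (bump 0 j) =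
   \sum_(i < (size u).+1) \sum_(j < (size v).+1)
       Qs (f \o cons a) (take i u) (b :: take j v) * Qs g (drop i u) (drop j v)
   + \sum_(i < (size u).+1) \sum_(j < (size v).+1)
       Qs (f \o cons b) (a :: take i u) (take j v) * Qs g (drop i u) (drop j v)
   + \sum_(i < (size u).+1) \sum_(j < (size v).+1)
   (if op a b is Some c then Qs (f \o cons c) (take i u) (take j v) else 0)
     * Qs g (drop i u) (drop j v).
  rewrite -!big_split; apply: eq_bigr => i _; rewrite -!big_split.
  by apply: eq_bigr => j _; rewrite /F /= Qs_cons !mulrDl.
rewrite E1 E2 E3; ring.
Qed.

Lemma conv_hom f g :
  is_hom op predT f -> is_hom op predT g -> is_hom op predT (conv f g).
Proof.
move=> [f1 fM] [g1 gM]; split=> [|u v _ _]; first by rewrite conv_nil f1 g1 mulr1.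
rewrite Qs_conv /conv mulr_suml; apply: eq_bigr => i _.
rewrite mulr_sumr; apply: eq_bigr => j _.
by rewrite -fM // -gM //; ring.
Qed.

End Convolution.

(** * Induction on the number of leading letters y *)

Section LeadingLetter.
Variables (A : eqType) (op : A -> A -> option A) (y : A).
Hypothesis opy : forall c d, op y c = Some d -> d != y.
Local Notation qsh := (qsh op).

Definition lead (w : seq A) := find (predC1 y) w.

Definition noy (w : seq A) := if w is c :: _ then c != y else true.

Lemma lead_nseq m v : noy v -> lead (nseq m y ++ v) = m.
Proof.
rewrite /lead; elim: m => [|m IH] /= vy; last by rewrite eqxx IH.
by case: v vy => //= c v ->.
Qed.

Lemma lead_decomp w : exists2 v, noy v & w = nseq (lead w) y ++ v.
Proof.
rewrite /lead; elim: w => [|a w [v vy IH]]; first by exists [::].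
rewrite /=; case: eqVneq => [->|ay] /=; last by exists (a :: w).
by exists v => //; rewrite -IH.
Qed.

(* The words of [y o (y^m v)] other than the [m + 1] copies of [y^(m+1) v]. *)
Fixpoint ins_rest m (v : seq A) : seq (seq A) :=
  match m with
  | 0 => if v is c :: v' then
           [seq c :: w | w <- qsh [:: y] v']
           ++ (if op y c is Some d then [:: d :: v'] else [::])
         else [::]
  | m'.+1 => [seq y :: w | w <- ins_rest m' v]
             ++ (if op y y is Some d then [:: d :: nseq m' y ++ v] else [::])
  end.

Lemma Qs_ins (R : comNzRingType) (f : seq A -> R) m v :
  Qs op f [:: y] (nseq m y ++ v) =
  m.+1%:R * f (nseq m.+1 y ++ v) + \sum_(w <- ins_rest m v) f w.
Proof.
elim: m f => [|m IH] f.
  case: v => [|c v] /=; first by rewrite Qss0 big_nil mul1r addr0.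
  rewrite Qs_cons Qs0s mul1r big_cat big_map /= addrA; congr (_ + _).
  by case: op => [d|]; rewrite ?Qs0s ?big_seq1 ?big_nil.
rewrite [nseq m.+1 y ++ v]/= Qs_cons Qs0s IH /= big_cat big_map /= !addrA.
congr (_ + _); last by case: op => [d|]; rewrite ?Qs0s ?big_seq1 ?big_nil.
by congr (_ + _); rewrite -[m.+2%:R]natr1; ring.
Qed.

Lemma ins_rest_sub m v w : w \in ins_rest m v -> w \in qsh [:: y] (nseq m y ++ v).
Proof.
elim: m w => [|m IH] w.
  case: v => // c v; rewrite [nseq 0 y ++ _]/= qsh_cons !mem_cat => /orP[->|].
    by rewrite !orbT.
  by case: op => // d /[!inE] ->; rewrite !orbT.
rewrite [nseq m.+1 y ++ v]/= qsh_cons !mem_cat => /orP[/mapP[w' /IH H ->]|].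
  by rewrite (map_f _ H) orbT.
by case: op => // d /[!inE] ->; rewrite !orbT.
Qed.

Lemma lead_ins m v w : noy v -> w \in ins_rest m v -> (lead w <= m)%N.
Proof.
move=> vy; elim: m w => [|m IH] w.
  case: v vy => //= c v cy; rewrite mem_cat => /orP[/mapP[w' _ ->]|].
    by rewrite /lead /= cy.
  by case E: op => [d|//]; rewrite inE => /eqP ->; rewrite /lead /= (opy E).
rewrite /= mem_cat => /orP[/mapP[w' /IH H ->]|]; first by rewrite /lead /= eqxx.
by case E: op => [d|//]; rewrite inE => /eqP ->; rewrite /lead /= (opy E).
Qed.

Definition qsh_closed (V : pred (seq A)) :=
  forall u v w, V u -> V v -> w \in qsh u v -> V w.

(** The regularization algorithm as an induction principle. By [Qs_ins], (m+1) y^(m+1) v is the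
    product of y with y^m v minus the words of [ins_rest]; since contractions with y never give y,
    these have at most m leading y. *)
Lemma lead_rect_prop (V : pred (seq A)) (P : seq A -> Prop) :
  V [:: y] -> qsh_closed V -> (forall w, V (y :: w) -> V w) ->
  (forall v, V v -> noy v -> P v) ->
  (forall m v, noy v -> V (nseq m y ++ v) -> P (nseq m y ++ v) ->
     (forall w, w \in ins_rest m v -> V w /\ P w) -> P (nseq m.+1 y ++ v)) ->
  forall w, V w -> P w.
Proof.
move=> Vy Vq Vt P0 PS w.
have [n] := ubnP (lead w); elim: n w => // n IH w; rewrite ltnS => lw Vw.
have [v vy Ew] := lead_decomp w.
case E: (lead w) lw Ew => [|m] lw Ew; first by move: Vw; rewrite Ew => Vw; apply: P0.
have Vm : V (nseq m y ++ v) by apply: Vt; rewrite Ew in Vw.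
rewrite Ew; apply: PS => //; first by apply: IH => //; rewrite lead_nseq.
move=> w' w'm; have Vw' : V w' by exact: Vq Vy Vm (ins_rest_sub w'm).
by split=> //; apply: IH => //; apply: leq_ltn_trans (lead_ins vy w'm) _.
Qed.

Lemma hom_unique (F : numFieldType) (V : pred (seq A)) (f g : seq A -> F) :
  V [:: y] -> qsh_closed V -> (forall w, V (y :: w) -> V w) ->
  is_hom op V f -> is_hom op V g -> f [:: y] = g [:: y] ->
  (forall v, V v -> noy v -> f v = g v) -> forall v, V v -> f v = g v.
Proof.
move=> Vy Vq Vt [_ fM] [_ gM] fgy fg0; apply: lead_rect_prop => // m v vy Vm fgm fgw.
have m0 : m.+1%:R != 0 :> F by rewrite pnatr_eq0.
apply: (mulfI m0); apply: (addIr (\sum_(w <- ins_rest m v) f w)).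
rewrite -Qs_ins -fM // {1}fgy fgm gM // Qs_ins; congr (_ + _).
by apply: eq_big_seq => w /fgw[_ ->].
Qed.

End LeadingLetter.

(** * The shuffle product: associativity, extension, antipode *)

Section Shuffle.
Variable A : eqType.

Definition sh_op (a b : A) : option A := None.

Variable R : numFieldType.
Implicit Types f g : seq A -> R.
Local Notation Sh := (@Qs A sh_op R).
Local Notation sh := (qsh sh_op).

Lemma sh_opC : commutative sh_op. Proof. by []. Qed.

Lemma Sh_cons f a u b v :
  Sh f (a :: u) (b :: v) = Sh (f \o cons a) u (b :: v) + Sh (f \o cons b) (a :: u) v.
Proof. by rewrite Qs_cons addr0. Qed.

(** Both sides are sorted by the first letter, which comes from [u], [v] or [w]. Different arguments
    shrink in the three cases, hence the induction on the total length. *)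
Lemma ShA f u v w : Sh (fun s => Sh f s w) u v = Sh (fun s => Sh f u s) v w.
Proof.
have [n] := ubnP (size u + size v + size w)%N.
elim: n u v w f => // n IH [|a u] [|b v] [|c w] f /=; rewrite ltnS => le_n.
all: try by rewrite !(Qs0s, Qss0).
all: try by rewrite !Qs0s; apply: eq_Qs => s; rewrite Qs0s.
all: try by rewrite !Qss0; apply: eq_Qs => s; rewrite Qss0.
all: try by rewrite Qss0; apply: eq_Qs => s; rewrite Qss0.
rewrite !Sh_cons.
have E a' c' u' v' w' : Sh ((fun s => Sh f s (c' :: w')) \o cons a') u' v'
   = Sh (fun s => Sh (f \o cons a') s (c' :: w')) u' v'
     + Sh (fun s => Sh (f \o cons c') (a' :: s) w') u' v'.
  by rewrite -QsD; apply: eq_Qs => s /=; rewrite Sh_cons.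
have E' a' b' u' v' w' : Sh ((fun s => Sh f (a' :: u') s) \o cons b') v' w'
   = Sh (fun s => Sh (f \o cons a') u' (b' :: s)) v' w'
     + Sh (fun s => Sh (f \o cons b') (a' :: u') s) v' w'.
  by rewrite -QsD; apply: eq_Qs => s /=; rewrite Sh_cons.
rewrite !E !E'.
rewrite (IH u (b :: v) (c :: w)) /=; last by move: le_n; rewrite /= !addSn !addnS.
rewrite (IH (a :: u) v (c :: w)) /=; last by move: le_n; rewrite /= !addSn !addnS.
rewrite addrACA.
have -> : Sh (fun s => Sh (f \o cons c) (a :: s) w) u (b :: v) +
          Sh (fun s => Sh (f \o cons c) (b :: s) w) (a :: u) v =
          Sh (fun s => Sh (f \o cons c) (a :: u) s) (b :: v) w.
  rewrite -(IH (a :: u) (b :: v) w); last by move: le_n; rewrite /= !addSn !addnS.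
  by rewrite Sh_cons.
have E2 : Sh (fun s => Sh (f \o cons a) u s) (b :: v) (c :: w) =
  Sh (fun s => Sh (f \o cons a) u (b :: s)) v (c :: w) +
  Sh (fun s => Sh (f \o cons a) u (c :: s)) (b :: v) w by rewrite Sh_cons.
rewrite E2; ring.
Qed.

Lemma Sh_nseq f (x : A) m : Sh f [:: x] (nseq m x) = m.+1%:R * f (nseq m.+1 x).
Proof.
rewrite -(cats0 (nseq m x)) Qs_ins cats0.
suff -> : ins_rest sh_op x m [::] = [::] by rewrite big_nil addr0.
by elim: m => //= m ->.
Qed.

Lemma sh_closed_noy (x : A) : qsh_closed sh_op (noy x).
Proof.
move=> [|a u] [|b v] w; rewrite ?qsh0s ?qshs0 ?inE => //; try by move=> ? ? /eqP ->.
by move=> /= ax bx /mem_qsh[w' ->|w' ->|].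
Qed.

Section Extension.
Variables (x : A) (f : seq A -> R).
Hypothesis f_hom : is_hom sh_op (noy x) f.

(** The closed formula (-1)^m a (x^m sh v) for the regularization of x^m a v. The words on which [f]
    is evaluated begin with [a], so they lie in its domain. *)
Definition extend (w : seq A) : R :=
  let m := lead x w in
  if drop m w is a :: v then (-1) ^+ m * Sh (f \o cons a) (nseq m x) v
  else (m == 0%N)%:R.

Lemma extend_cons m a v : a != x ->
  extend (nseq m x ++ a :: v) = (-1) ^+ m * Sh (f \o cons a) (nseq m x) v.
Proof. by move=> ax; rewrite /extend lead_nseq //= drop_size_cat // size_nseq. Qed.

Lemma extend_nseq m : extend (nseq m x) = (m == 0%N)%:R.
Proof.
by rewrite /extend -[nseq m x]cats0 lead_nseq // cats0 drop_oversize // size_nseq.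
Qed.

Lemma extend_noy w : noy x w -> extend w = f w.
Proof.
case: w => [_|a w ax]; first by rewrite (extend_nseq 0) (f_hom.1).
by rewrite -[a :: w]/(nseq 0 x ++ a :: w) extend_cons // mul1r Qs0s.
Qed.

Lemma ins_rest_sh m a v :
  ins_rest sh_op x m (a :: v) = [seq nseq m x ++ a :: w | w <- sh [:: x] v].
Proof.
elim: m => [|m IH] /=; first by rewrite cats0.
by rewrite IH cats0 -map_comp.
Qed.

(** The m+1 copies of x^(m+1) a v cancel against the insertions of x behind [a], because
    associativity turns x sh (x^m sh v) into m+1 times x^(m+1) sh v, with the opposite sign. *)
Lemma extend_letter w : Sh extend [:: x] w = 0.
Proof.
have [[|a v] vx ->] := lead_decomp x w; move: (lead x w) => m.
  by rewrite cats0 Sh_nseq extend_nseq mulr0.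
rewrite Qs_ins extend_cons // ins_rest_sh big_map.
under eq_bigr do rewrite extend_cons //.
rewrite -mulr_sumr -/(Sh (fun s => Sh (f \o cons a) (nseq m x) s) [:: x] v).
have -> : Sh (fun s => Sh (f \o cons a) (nseq m x) s) [:: x] v =
          m.+1%:R * Sh (f \o cons a) (nseq m.+1 x) v.
  by rewrite -ShA (QsC sh_opC) Sh_nseq.
by rewrite exprS; ring.
Qed.

Lemma eq_killed_by_letter (g h : seq A -> R) :
  (forall w, Sh g [:: x] w = 0) -> (forall w, Sh h [:: x] w = 0) ->
  (forall w, noy x w -> g w = h w) -> g =1 h.
Proof.
move=> g0 h0 gh w; move: w (erefl : predT w).
apply: (@lead_rect_prop _ sh_op x) => // [w _|m v vx _ _ IH]; first exact: gh.
have m0 : m.+1%:R != 0 :> R by rewrite pnatr_eq0.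
apply: (mulfI m0); apply: (addIr (\sum_(w <- ins_rest sh_op x m v) g w)).
rewrite -Qs_ins g0; apply: esym; rewrite -[RHS](h0 (nseq m x ++ v)) Qs_ins.
by congr (_ + _); apply: eq_big_seq => w /IH[_ ->].
Qed.

(** Both sides vanish on multiples of x, as functions of [v] and then of [u]. It is therefore enough
    to compare them on words without leading x, where [f] is multiplicative. *)
Lemma extend_hom : is_hom sh_op predT extend.
Proof.
have killl u w : Sh (fun s => Sh extend u s) [:: x] w = 0.
  rewrite -ShA (QsC sh_opC) ShA -[RHS](Qs0 sh_op R u w).
  by apply: eq_Qs => s; rewrite extend_letter.
have killr u w : Sh (fun s => Sh extend s u) [:: x] w = 0.
  by rewrite -[RHS](killl u w); apply: eq_Qs => s; rewrite (QsC sh_opC).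
have kill c w : Sh (fun s => c * extend s) [:: x] w = 0.
  by rewrite QsZ extend_letter mulr0.
split=> [|u v _ _]; first by rewrite (extend_nseq 0).
apply: (@eq_killed_by_letter (fun v => extend u * extend v)) => // {}v vx.
rewrite mulrC; move: u.
apply: (@eq_killed_by_letter (fun u => extend v * extend u) (fun u => Sh extend u v)) => // u ux.
rewrite mulrC !extend_noy // f_hom.2 //; apply: eq_in_Qs => w wuv.
by rewrite extend_noy //; apply: sh_closed_noy wuv.
Qed.

End Extension.

(** Each product splits by the origin of its first letter: the end of the prefix ([T i]) or the
    start of the suffix ([T' i], equal to [T i.+1]). The alternating signs make the sum
    telescope. *)
Lemma antipode f (w : seq A) : (0 < size w)%N ->
  \sum_(i < (size w).+1)
    (-1) ^+ i * Sh f (rev (take i w)) (drop i w) = 0.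
Proof.
case E0: w => [//|a w']; rewrite -E0 => _.
pose T i := if i is j.+1 then
  Sh (f \o cons (nth a w j)) (rev (take j w)) (drop j.+1 w) else 0.
pose T' i := if (i < size w)%N then T i.+1 else 0.
have E i : (i <= size w)%N -> Sh f (rev (take i w)) (drop i w) = T i + T' i.
  case: i => [_|i lei].
    have -> : T' 0%N = T 1%N by rewrite /T' E0.
    by rewrite add0r /T !take0 drop0 !Qs0s E0 /= drop0.
  rewrite (take_nth a) // rev_rcons /T'.
  case: ltnP => [lt|ge]; last by rewrite addr0 /T drop_oversize // !Qss0.
  rewrite (drop_nth a lt) Sh_cons /T [in X in _ = X + _](drop_nth a lt).
  by rewrite (take_nth a lei) rev_rcons.
rewrite (eq_bigr (fun i : 'I_(size w).+1 => (-1) ^+ i * T i + (-1) ^+ i * T' i));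
  last by move=> i _; rewrite E ?mulrDr // -ltnS.
rewrite big_split /= big_ord_recl mulr0 add0r [X in _ + X]big_ord_recr /=.
rewrite {2}/T' ltnn mulr0 addr0 -big_split big1 // => i _.
by rewrite /= /bump add1n /T' ltn_ord exprS mulN1r mulNr addNr.
Qed.
End Shuffle.

(** * Cyclic words modulo products *)

Section QSubspace.
Variable R : numFieldType.

Record qsubspace (X : R -> Prop) : Prop := {
  qsub0 : X 0;
  qsubD : forall a b, X a -> X b -> X (a + b);
  qsubZ : forall (q : rat) a, X a -> X (ratr q * a) }.

Variable X : R -> Prop.
Hypothesis XQ : qsubspace X.

Lemma qsubN a : X a -> X (- a).
Proof. by move=> /(qsubZ XQ (-1)); rewrite rmorphN1 mulN1r. Qed.

Lemma qsubB a b : X a -> X b -> X (a - b).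
Proof. by move=> Xa /qsubN; apply: qsubD. Qed.

Lemma qsub_sign i a : X a -> X ((-1) ^+ i * a).
Proof. by move=> /(qsubZ XQ ((-1) ^+ i)); rewrite rmorphXn rmorphN1. Qed.

Lemma qsub_sum (I : eqType) (r : seq I) (P : pred I) (F : I -> R) :
  (forall i, i \in r -> P i -> X (F i)) -> X (\sum_(i <- r | P i) F i).
Proof.
move=> H; rewrite big_seq_cond; apply: big_ind => [|a b|i /andP[ir Pi]].
- exact: qsub0 XQ.
- exact: qsubD XQ a b.
- exact: H.
Qed.

Lemma qsub_natmul n a : X a -> X (n%:R * a).
Proof. by move=> /(qsubZ XQ n%:R); rewrite rmorph_nat. Qed.

Lemma qsub_natdiv n a : (0 < n)%N -> X (n%:R * a) -> X a.
Proof.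
move=> n0 /(qsubZ XQ n%:R^-1); rewrite fmorphV rmorph_nat mulKf //.
by rewrite pnatr_eq0 -lt0n.
Qed.

Lemma qsub_congr a b : X (a - b) -> X b -> X a.
Proof. by move=> Xab Xb; rewrite -(subrK b a); apply: qsubD. Qed.

Section Cyclic.
Variables (g : seq bool -> R) (n : nat).
Hypothesis g_hom : is_hom (@sh_op bool) predT g.
Hypothesis g_prod : forall u v, u != [::] -> v != [::] ->
  (size u + size v)%N = n.+1 -> X (g u * g v).
Hypothesis g_dual : forall w, g (rev (map negb w)) = g w.
Hypothesis g_true : g [:: true] = 0.
Hypothesis g_rot : forall w, size w = n -> X (g (rcons w true) - g (true :: w)).

(** In the antipode relation all terms except the two extreme ones are products of values at
    nonempty words. *)
Lemma antipode_mod w : size w = n.+1 -> X (g w + (-1) ^+ n.+1 * g (rev w)).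
Proof.
move=> wn; have w0 : (0 < size w)%N by rewrite wn.
have := antipode g w0; rewrite big_ord_recr /= take_size drop_size Qss0.
rewrite wn big_ord_recl /= mul1r drop0 take0 /= Qs0s addrAC => /eqP.
rewrite addr_eq0 => /eqP ->; apply/qsubN/qsub_sum => i _ _.
apply: qsub_sign; rewrite -g_hom.2 //.
have lti : (bump 0 i < size w)%N by rewrite wn /bump add1n ltnS ltn_ord.
apply: g_prod; rewrite -?size_eq0 ?size_rev ?size_drop ?size_takel ?subn_eq0 -?ltnNge //;
  try exact: ltnW.
by rewrite subnKC // ltnW.
Qed.

Lemma negb_mod w : size w = n.+1 -> X (g w + (-1) ^+ n.+1 * g (map negb w)).
Proof.
move=> wn; have := antipode_mod wn.
by rewrite -(g_dual (rev w)) map_rev revK.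
Qed.

Lemma rot1_mod a w : size w = n -> X (g (rcons w a) - g (a :: w)).
Proof.
move=> wn; case: a; first exact: g_rot.
have wn1 : size (rcons w false) = n.+1 by rewrite size_rcons wn.
have wn2 : size (false :: w) = n.+1 by rewrite /= wn.
have wn3 : size (map negb w) = n by rewrite size_map.
(* Negating all letters turns the rotation of [false] into one of [true], up to a common sign. *)
have := qsubB (qsubB (negb_mod wn1) (negb_mod wn2)) (qsub_sign n.+1 (g_rot wn3)).
rewrite map_rcons /=; congr X; ring.
Qed.

Lemma rot_mod i w : (i <= size w)%N -> size w = n.+1 -> X (g (rot i w) - g w).
Proof.
elim: i => [|i IH] lei wn; first by rewrite rot0 subrr; apply: qsub0 XQ.
have wi : size (rot i w) = n.+1 by rewrite size_rot.
have := IH (ltnW lei) wn; rewrite (rotS lei).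
case: (rot i w) wi => // a v [vn] /(qsubD XQ (rot1_mod a vn)).
by rewrite rot1_cons; congr X; ring.
Qed.

Lemma Sh_letter (f : seq bool -> R) a v :
  Qs (@sh_op bool) f [:: a] v = \sum_(i < (size v).+1) f (take i v ++ a :: drop i v).
Proof.
elim: v f => [|b v IH] f; first by rewrite Qss0 big_ord1.
by rewrite Sh_cons Qs0s IH [RHS]big_ord_recl; congr (_ + _).
Qed.

Lemma sum_rot (F : seq bool -> R) j v : (j <= size v)%N ->
  \sum_(i < size v) F (rot i (rot j v)) = \sum_(i < size v) F (rot i v).
Proof.
elim: j => [|j IH] lej; first by rewrite rot0.
rewrite -IH 1?ltnW // (rotS lej); move: (rot j v) (size_rot j v) => u usz.
rewrite -usz; case E: (size u) => [|m]; first by rewrite !big_ord0.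
rewrite (eq_bigr (fun i : 'I_m.+1 => F (rot i.+1 u))); last first.
  by move=> i _; rewrite -rotD ?addn1 // E.
by rewrite big_ord_recr [RHS]big_ord_recl /= -E rot_size rot0 addrC.
Qed.

Lemma cyclic_mod w : size w = n.+1 -> X (g w).
Proof.
have yX v : size v = n -> X (g (true :: v)).
  move=> vn; pose F u := g (true :: u).
  have XS u : size u = n -> X (\sum_(i < n) F (rot i u) + F u).
    move=> un; have : \sum_(i < (size u).+1) g (take i u ++ true :: drop i u) = 0.
      by rewrite -Sh_letter -g_hom.2 // g_true mul0r.
    rewrite un => E.
    (* Rotating the inserted [true] to the front changes each value by an element of [X]. The last
       of the n+1 summands is a full rotation and gives [F u]. *)
    have : X (\sum_(i < n.+1) F (rot i u)
       - \sum_(i < n.+1) g (take i u ++ true :: drop i u)).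
      rewrite -sumrB; apply: qsub_sum => i _ _.
      have lei : (i <= size u)%N by rewrite un -ltnS.
      have Erot : rot i (take i u ++ true :: drop i u) = true :: rot i u.
        by rewrite -{1}(size_takel lei) rot_size_cat.
      rewrite /F -Erot; apply: rot_mod.
        by rewrite size_cat size_takel // leq_addr.
      by rewrite size_cat /= addnS -size_cat cat_take_drop un.
    by rewrite E subr0 big_ord_recr /= (rot_oversize (n := n)) ?un.
  suff XN : X (\sum_(i < n) F (rot i v)).
    by apply: (qsub_congr _ (qsubN XN)); rewrite opprK addrC; apply: XS.
  apply: (@qsub_natdiv n.+1) => //.
  have -> : n.+1%:R * \sum_(i < n) F (rot i v) =
      \sum_(j < n) (\sum_(i < n) F (rot i (rot j v)) + F (rot j v)).
    rewrite big_split /= -natr1 mulrDl mul1r; congr (_ + _).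
    rewrite [RHS](eq_bigr (fun=> \sum_(i < n) F (rot i v))).
      by rewrite sumr_const card_ord mulr_natl.
    by move=> j _; have := @sum_rot F j v; rewrite vn; apply; exact: ltnW.
  by apply: qsub_sum => j _ _; apply: XS; rewrite size_rot.
case: w => // -[] v [vn]; first exact: yX.
have wn : size (false :: v) = n.+1 by rewrite /= vn.
apply: (qsub_congr (b := - ((-1) ^+ n.+1 * g (true :: map negb v)))).
  by rewrite opprK; apply: negb_mod.
by apply/qsubN/qsub_sign/yX; rewrite size_map.
Qed.

End Cyclic.
End QSubspace.

(* In a list of naturals that encodes an index, the letter [a] stands for the
   entry [a + 1], and the head belongs to the largest summation variable. *)
Definition st_op (a b : nat) : option nat := Some (a + b).+1.

Lemma st_op0 c d : st_op 0 c = Some d -> d != 0%N.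
Proof. by case=> <-. Qed.

Definition wt (r : seq nat) : nat := (sumn r + size r)%N.

Lemma wt_cons a r : wt (a :: r) = (a.+1 + wt r)%N.
Proof. by rewrite /wt /=; lia. Qed.

Lemma wt_cat u v : wt (u ++ v) = (wt u + wt v)%N.
Proof. by rewrite /wt sumn_cat size_cat; lia. Qed.

Lemma wt_rev r : wt (rev r) = wt r.
Proof. by rewrite /wt sumn_rev size_rev. Qed.

Lemma wt_nseq0 n : wt (nseq n 0%N) = n.
Proof. by rewrite /wt sumn_nseq size_nseq; lia. Qed.

Lemma wt_qsh u v w : w \in qsh st_op u v -> wt w = (wt u + wt v)%N.
Proof.
move: u v w; apply: size_ind2 => [v w|u w|a u b v IH1 IH2 IH3 w].
- by rewrite qsh0s inE => /eqP ->.
- by rewrite qshs0 inE addn0 => /eqP ->.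
case/mem_qsh => [w' ->|w' ->|c w' [<-] ->].
- by move/IH1; rewrite !wt_cons; lia.
- by move/IH2; rewrite !wt_cons; lia.
- by move/IH3; rewrite !wt_cons; lia.
Qed.

(** * Functionals on indices under the stuffle product *)

Section Twist.
Variable R : comNzRingType.
Implicit Types f g : seq nat -> R.

Definition twist (f : seq nat -> R) w := (-1) ^+ wt w * f w.

Lemma Qs_twist f u v :
  Qs st_op (twist f) u v = (-1) ^+ (wt u + wt v) * Qs st_op f u v.
Proof.
by rewrite -QsZ; apply: eq_in_Qs => w /wt_qsh E; rewrite /twist E.
Qed.

Lemma twist_hom f : is_hom st_op predT f -> is_hom st_op predT (twist f).
Proof.
move=> [f1 fM]; split=> [|u v _ _]; first by rewrite /twist f1 mulr1.
by rewrite Qs_twist -fM // /twist exprD; ring.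
Qed.

Lemma twist_conv f g w : twist (conv f g) w = conv (twist f) (twist g) w.
Proof.
rewrite /twist /conv mulr_sumr; apply: eq_bigr => i _.
by rewrite -{1}(cat_take_drop i w) wt_cat exprD; ring.
Qed.

Lemma rev_hom f : is_hom st_op predT f -> is_hom st_op predT (f \o rev).
Proof.
move=> [f1 fM]; split=> [|u v _ _]; first by rewrite /= f1.
by rewrite /= fM // Qs_rev.
Qed.

Lemma conv_nseq (f g : seq nat -> R) n : conv f g (nseq n 0%N) =
  \sum_(i < n.+1) f (nseq i 0%N) * g (nseq (n - i) 0%N).
Proof.
rewrite /conv size_nseq; apply: eq_bigr => i _.
by rewrite take_nseq ?drop_nseq // -ltnS.
Qed.

Lemma conv_nseqC (f g : seq nat -> R) n :
  conv f g (nseq n 0%N) = conv g f (nseq n 0%N).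
Proof.
rewrite !conv_nseq (reindex_inj rev_ord_inj) /=; apply: eq_bigr => i _.
by rewrite subSS subKn 1?mulrC // -ltnS.
Qed.

(** A power series stored as a functional supported on the indices 1^n; convolution of such
    functionals is multiplication of series. *)
Definition ones_fun (a : nat -> R) (w : seq nat) :=
  if w == nseq (size w) 0%N then a (size w) else 0.

Lemma ones_fun_nseq a n : ones_fun a (nseq n 0%N) = a n.
Proof. by rewrite /ones_fun size_nseq eqxx. Qed.

Lemma ones_fun_cons a c w : ones_fun a (c :: w) =
  if c == 0%N then ones_fun (a \o succn) w else 0.
Proof. by rewrite /ones_fun /= eqseq_cons; case: eqP. Qed.

Lemma ones_fun_rev a w : ones_fun a (rev w) = ones_fun a w.
Proof.
by rewrite /ones_fun size_rev -(inj_eq (can_inj revK)) revK rev_nseq.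
Qed.

(* A functional is determined by its values on the stuffle products [v * 1^m]
   with [v] convergent; the letter [0] encodes the entry 1 of an index. *)
Lemma st_lead (h : seq nat -> R) m v : noy 0%N v ->
  (forall w, (lead 0%N w < m)%N -> h w = 0) ->
  Qs st_op h v (nseq m 0%N) = h (nseq m 0%N ++ v).
Proof.
move=> vy; elim: m h => [|m IH] h h0; first by rewrite Qss0.
case: v IH vy => [|a v] IH ay; first by rewrite Qs0s cats0.
rewrite [nseq m.+1 _]/= Qs_cons /= addn0.
rewrite (@eq_Qs _ _ _ (h \o cons a) (fun=> 0)) ?Qs0 ?add0r; last first.
  by move=> w; rewrite /= h0 // /lead /= (ay : a != 0%N).
rewrite (@eq_Qs _ _ _ (h \o cons a.+1) (fun=> 0)) ?Qs0 ?addr0; last first.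
  by move=> w; rewrite /= h0.
by rewrite IH // => w lw; rewrite /= h0.
Qed.

(** Induction on the number of leading [0]: if the difference vanishes on words with fewer of them,
    [st_lead] leaves a single word of the product, with coefficient 1. *)
Lemma st_determined (f g : seq nat -> R) :
  (forall v m, noy 0%N v ->
    Qs st_op f v (nseq m 0%N) = Qs st_op g v (nseq m 0%N)) -> f =1 g.
Proof.
move=> fg w; apply/eqP; rewrite -subr_eq0; apply/eqP.
pose h w := f w + (-1) * g w.
suff H n : forall w, (lead 0%N w < n)%N -> h w = 0.
  by have := H _ w (leqnn _); rewrite /h mulN1r.
elim: n => // n IH {}w; rewrite ltnS leq_eqVlt => /orP[/eqP E|/IH //].
have [v vy Ew] := lead_decomp 0%N w.
rewrite Ew E -st_lead // /h QsD QsZ fg //; ring.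
Qed.
End Twist.

Section Inverse.
Variables (R : comNzRingType) (b : nat -> R).

(** Coefficients of the inverse of the series of [b] when [b 0] is 1. Each coefficient depends on
    all earlier ones, so the recursion carries the whole list. *)
Fixpoint inv_seq n : seq R :=
  if n is m.+1 then
    let s := inv_seq m in
    rcons s (- \sum_(i < m.+1) nth 0 s i * b (m.+1 - i)%N)
  else [:: 1].

Definition inv_series n := nth 0 (inv_seq n) n.

Lemma size_inv_seq n : size (inv_seq n) = n.+1.
Proof. by elim: n => //= n IH; rewrite size_rcons IH. Qed.

Lemma nth_inv_seq n i : (i <= n)%N -> nth 0 (inv_seq n) i = inv_series i.
Proof.
elim: n => [|n IH]; first by rewrite leqn0 => /eqP ->.
rewrite leq_eqVlt => /orP[/eqP -> //|]; rewrite ltnS => lei.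
by rewrite /= nth_rcons size_inv_seq ltnS lei IH.
Qed.

Lemma inv_series0 : inv_series 0 = 1. Proof. by []. Qed.

Lemma inv_seriesS n : inv_series n.+1 =
  - \sum_(i < n.+1) inv_series i * b (n.+1 - i)%N.
Proof.
rewrite /inv_series /= nth_rcons size_inv_seq ltnn eqxx; congr (- _).
by apply: eq_bigr => i _; rewrite nth_inv_seq // -ltnS.
Qed.
End Inverse.

Section Span.
Variable R : realType.
Implicit Types S X : set R.

Lemma Qspan_sub S : qsubspace (Qspan S).
Proof.
split=> [|a b [s sS ->] [t tS ->]|q a [s sS ->]].
- by exists [::]; rewrite ?big_nil.
- exists (s ++ t); last by rewrite big_cat.
  by move=> p; rewrite mem_cat => /orP[/sS|/tS].
exists [seq (q * p.1, p.2) | p <- s].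
  by move=> p /mapP[p' /sS H ->].
rewrite big_map mulr_sumr; apply: eq_bigr => p _.
by rewrite rmorphM mulrA.
Qed.

Lemma Qspan_gen S a : S a -> Qspan S a.
Proof.
move=> Sa; exists [:: (1, a)]; last by rewrite big_seq1 rmorph1 mul1r.
by move=> p; rewrite inE => /eqP ->.
Qed.

Lemma Qspan_min S X : qsubspace X -> (forall a, S a -> X a) ->
  forall a, Qspan S a -> X a.
Proof.
move=> XQ SX _ [s sS ->]; apply: qsub_sum => // p ps _.
by apply: (qsubZ XQ); apply: SX; apply: sS.
Qed.

Lemma qsub_mulr X c : qsubspace X -> qsubspace (fun a => X (a * c)).
Proof.
move=> XQ; split=> [|a b|q a] /=; first by rewrite mul0r; exact: (qsub0 XQ).
  by rewrite mulrDl; exact: (qsubD XQ).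
by rewrite -(mulrA (ratr q)); exact: (qsubZ XQ).
Qed.

Lemma qsub_mull X c : qsubspace X -> qsubspace (fun a => X (c * a)).
Proof.
move=> XQ; split=> [|a b|q a] /=; first by rewrite mulr0; exact: (qsub0 XQ).
  by rewrite mulrDr; exact: (qsubD XQ).
by rewrite (mulrCA c (ratr q)); exact: (qsubZ XQ).
Qed.
End Span.

(** * Products in the span of the finite values *)

Section Products.
Variables (R : realType) (Z : nat -> set R) (Zs Zst : seq nat -> R).
Hypotheses (Z_sub : forall i, qsubspace (Z i)) (Z1 : Z 0%N 1).
Hypothesis ZM : forall i j a b, Z i a -> Z j b -> Z (i + j)%N (a * b).
Hypothesis Zst_hom : is_hom st_op predT Zst.
Hypothesis Zst1 : Zst [:: 0%N] = 0.
Hypothesis Zst_adm : forall v, noy 0%N v -> Zst v = Zs v.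
Hypothesis Zs_adm : forall v r, noy 0%N v -> Qs st_op Zs v r = Zs v * Zs r.
Hypothesis Zs_nil : Zs [::] = 1.
Hypothesis Zs_ones : forall m, Zs (nseq m.+1 0%N) = 0.
Hypothesis Zst_Z : forall r, Z (wt r) (Zst r).

(* [ZFst] is the stuffle analogue of [ZF]; unlike [ZF] it is multiplicative. *)
Definition ZF := conv (Zs \o rev) (twist Zs).
Definition ZFst := conv (Zst \o rev) (twist Zst).

Let b n := Zst (nseq n 0%N).
Let a := inv_series b.

Lemma Zst_ones0 : b 0 = 1. Proof. exact: Zst_hom.1. Qed.

Lemma inv_ones_conv n : \sum_(i < n.+2) a i * b (n.+1 - i)%N = 0.
Proof.
by rewrite big_ord_recr /= subnn Zst_ones0 mulr1 {2}/a inv_seriesS subrr.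
Qed.

Lemma Zst_ones_Z n : Z n (b n).
Proof. by rewrite -{1}(wt_nseq0 n); apply: Zst_Z. Qed.

Lemma inv_ones_Z n : Z n (a n).
Proof.
have [m] := ubnP n; elim: m n => // m IH [|n] ltn; first by [].
rewrite /a inv_seriesS; apply: (qsubN (Z_sub _)); apply: (qsub_sum (Z_sub _)) => i _ _.
have lei : (i <= n.+1)%N by apply/ltnW.
rewrite -{1}(subnKC lei); apply: ZM; last exact: Zst_ones_Z.
by apply: IH; apply: leq_trans (ltn_ord i) _.
Qed.

Lemma Qs_conv_ones (c : nat -> R) v m : noy 0%N v ->
  Qs st_op (conv (ones_fun c) Zst) v (nseq m 0%N) =
  Zs v * \sum_(i < m.+1) c i * b (m - i)%N.
Proof.
move=> vy.
(* Only a leading [0] reaches the tail of the series. In a product of [v] with 1^m such a letter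
   must come from 1^m, since [v] does not begin with [0] and merged letters are nonzero; this lowers
   m by one. *)
have E c' w : conv (ones_fun c') Zst w = c' 0%N * Zst w +
    if w is 0 :: w' then conv (ones_fun (c' \o succn)) Zst w' else 0.
  case: w => [|x w]; first by rewrite conv_nil addr0.
  rewrite conv_cons; congr (_ + _).
  case: x => [|x]; first by apply: eq_conv => // s /=; rewrite ones_fun_cons.
  by rewrite /conv big1 // => i _; rewrite /= ones_fun_cons mul0r.
elim: m c => [|m IH] c.
  rewrite big_ord1 Qss0 E Zst_adm //.
  by case: v vy => [|[|x] v] //= _; rewrite addr0 mulrC Zst_ones0 mulr1.
rewrite (eq_Qs st_op v (nseq m.+1 0%N) (E c)) QsD QsZ -Zst_hom.2 // Zst_adm //.
rewrite big_ord_recl mulrDr mulrCA subn0; congr (_ + _).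
rewrite (eq_bigr (fun i : 'I_m.+1 => (c \o succn) i * b (m - i))) //.
rewrite -IH.
case: v vy {IH} => [|[|x] v] //= _; first by rewrite !Qs0s.
rewrite Qs_cons (@eq_Qs _ _ _ (_ \o cons x.+1) (fun=> 0)) // Qs0 add0r.
rewrite [X in _ + X](_ : _ = 0) ?addr0 //.
exact: (Qs0 st_op R v (nseq m 0%N)).
Qed.

(** Comparison of the two regularizations. On the product of a convergent [v] with 1^m both sides
    are [Zs v] for m = 0 and 0 for m > 0: the left because [Zs] kills 1^m, the right because [a]
    inverts [b]. *)
Lemma Zs_conv_ones : Zs =1 conv (ones_fun a) Zst.
Proof.
apply: st_determined => v m vy; rewrite Qs_conv_ones // Zs_adm //.
case: m => [|m]; last by rewrite inv_ones_conv Zs_ones.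
by rewrite big_ord1 /a inv_series0 Zst_ones0 mulr1 Zs_nil.
Qed.

(* The product of the generating series of [a n] and of [(-1)^n a n]: it
   measures the difference between [ZF] and [ZFst]. *)
Let c n := \sum_(i < n.+1) a i * ((-1) ^+ (n - i) * a (n - i)%N).

Lemma conv_ones w : conv (ones_fun a) (twist (ones_fun a)) w = ones_fun c w.
Proof.
rewrite [RHS]/ones_fun; case: (w =P nseq (size w) 0%N) => [->|nw].
  rewrite conv_nseq size_nseq; apply: eq_bigr => i _.
  by rewrite /twist !ones_fun_nseq wt_nseq0.
rewrite /conv big1 // => i _; rewrite /twist /ones_fun.
case: (take i w =P _) => [E1|_]; last by rewrite mul0r.
case: (drop i w =P _) => [E2|_]; last by rewrite !mulr0.
case: nw; rewrite -{1}(cat_take_drop i w) E1 E2 -nseqD.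
by rewrite -size_cat cat_take_drop.
Qed.

(** The correction factors of the two halves meet at the cut, by associativity of [conv], and
    combine into [c]. *)
Lemma ZF_conv w : ZF w = conv (Zst \o rev) (conv (ones_fun c) (twist Zst)) w.
Proof.
have E1 s : (Zs \o rev) s = conv (Zst \o rev) (ones_fun a) s.
  rewrite /= Zs_conv_ones conv_rev; apply: eq_conv => // t /=.
  by rewrite ones_fun_rev.
have E2 s : twist Zs s = conv (twist (ones_fun a)) (twist Zst) s.
  by rewrite -twist_conv /twist Zs_conv_ones.
rewrite /ZF (eq_conv E1 E2) convA; apply: eq_conv => // s.
by rewrite -convA; apply: eq_conv => // t; rewrite conv_ones.
Qed.

Lemma inv_ones0 : a 0 = 1. Proof. by []. Qed.

Lemma ones_corr0 : c 0 = 1.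
Proof. by rewrite /c big_ord1 inv_ones0 !mulr1. Qed.

Lemma ones_corr_Z n : Z n (c n).
Proof.
apply: (qsub_sum (Z_sub _)) => i _ _; rewrite mulrCA; apply: (qsub_sign (Z_sub _)).
rewrite -{1}(@subnKC i n) -1?ltnS //.
by apply: ZM; apply: inv_ones_Z.
Qed.

Lemma ZFst_hom : is_hom st_op predT ZFst.
Proof. by apply: conv_hom; [apply: rev_hom|apply: twist_hom]. Qed.

Lemma twist_Z (f : seq nat -> R) r : Z (wt r) (f r) -> Z (wt r) (twist f r).
Proof. exact: (qsub_sign (Z_sub _)). Qed.

Lemma conv_Z (f g : seq nat -> R) w : (forall r, Z (wt r) (f r)) ->
  (forall r, Z (wt r) (g r)) -> Z (wt w) (conv f g w).
Proof.
move=> fZ gZ; apply: (qsub_sum (Z_sub _)) => i _ _.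
by rewrite -{1}(cat_take_drop i w) wt_cat; apply: ZM.
Qed.

Lemma Zs_Z r : Z (wt r) (Zs r).
Proof.
rewrite Zs_conv_ones; apply: conv_Z => // s; rewrite /ones_fun; case: (s =P _) => [->|_].
  by rewrite wt_nseq0 size_nseq; apply: inv_ones_Z.
exact: (qsub0 (Z_sub _)).
Qed.

Lemma ZF_Z w : Z (wt w) (ZF w).
Proof.
by apply: conv_Z => r; [rewrite -(wt_rev r); apply: Zs_Z|apply/twist_Z/Zs_Z].
Qed.

Lemma ZFst_Z w : Z (wt w) (ZFst w).
Proof.
by apply: conv_Z => r; [rewrite -(wt_rev r); apply: Zst_Z|apply/twist_Z/Zst_Z].
Qed.

(** The term with [c 0 = 1] is [ZFst w]; the others carry some [c n] with n > 0. [Y] is left free so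
    that the bound can be used inside a product with a further factor. *)
Lemma ZF_ZFst (Y : set R) w : qsubspace Y ->
  (forall n d, (0 < n)%N -> (n <= wt w)%N -> Z (wt w - n)%N d -> Y (c n * d)) ->
  Y (ZF w - ZFst w).
Proof.
move=> YQ Yc; rewrite ZF_conv /ZFst /conv -sumrB; apply: (qsub_sum YQ) => i _ _.
rewrite -mulrBr big_ord_recl /= take0 drop0 (ones_fun_nseq _ 0) ones_corr0 mul1r addrC addKr.
rewrite mulr_sumr; apply: (qsub_sum YQ) => j _ _.
set s := drop i w; set t := drop _ s; rewrite /ones_fun.
case: (_ =P _) => [E|_]; last by rewrite mul0r mulr0; exact: (qsub0 YQ).
have Ew : w = take i w ++ nseq (size (take (bump 0 j) s)) 0%N ++ t.
  by rewrite -E !cat_take_drop.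
have sz : size (take (bump 0 j) s) = j.+1.
  by rewrite size_takel // /bump add1n -ltnS ltn_ord.
have wE : wt w = (wt (take i w) + (j.+1 + wt t))%N.
  by rewrite {1}Ew !wt_cat wt_nseq0 sz.
rewrite sz mulrCA; apply: Yc => //; first by rewrite wE; lia.
have -> : (wt w - j.+1 = wt (rev (take i w)) + wt t)%N by rewrite wE wt_rev; lia.
by apply: ZM; [apply: Zst_Z|apply/twist_Z/Zst_Z].
Qed.

Let g n := ZFst (nseq n 0%N).

Lemma ZFst_ones_Z n : Z n (g n).
Proof. by rewrite -{1}(wt_nseq0 n); apply: ZFst_Z. Qed.

(** The sum is [ZF] at 1^(n+1), where every term has a factor [Zs] at a positive power of 1. So [c]
    is the series inverse to [g]. *)
Lemma ones_corr_inverse n : \sum_(j < n.+2) g j * c (n.+1 - j)%N = 0.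
Proof.
transitivity (ZF (nseq n.+1 0%N)).
  rewrite ZF_conv [RHS]conv_nseq.
  transitivity (conv (Zst \o rev) (conv (twist Zst) (ones_fun c)) (nseq n.+1 0%N)).
    by rewrite -convA conv_nseq; apply: eq_bigr => i _; rewrite ones_fun_nseq.
  by rewrite conv_nseq; apply: eq_bigr => i _; rewrite conv_nseqC.
rewrite /ZF conv_nseq big1 // => -[[|i] lti] _.
  by rewrite subn0 /twist Zs_ones !mulr0.
by rewrite /comp rev_nseq Zs_ones mul0r.
Qed.

Lemma ZFst_ones0 : g 0 = 1. Proof. exact: ZFst_hom.1. Qed.

(* Newton's identities: the index [1^m] is an elementary symmetric function. *)
Lemma ZFst_newton m : m.+1%:R * g m.+1 =
  \sum_(i < m.+1) (-1) ^+ i * ZFst [:: val i] * g (m - i)%N.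
Proof.
(* [W f x m] sums [f] over the m+1 positions of the letter [x] among m letters [0]. Stuffling [x]
   with 1^(n+1) gives [W] at [x] plus, from the contractions, [W] at [x.+1]; iterating from [x = 0]
   yields the identity. *)
pose W := fix W (f : seq nat -> R) x m := if m is m'.+1
  then f (x :: nseq m 0%N) + W (f \o cons 0%N) x m' else f [:: x].
have W0 f n : W f 0%N n = n.+1%:R * f (nseq n.+1 0%N).
  elim: n f => [|n IH] f; first by rewrite mul1r.
  by rewrite /= IH -[in RHS]nat1r mulrDl mul1r.
have QW f x n : Qs st_op f [:: x] (nseq n.+1 0%N) = W f x n.+1 + W f x.+1 n.
  elim: n f => [|n IH] f.
    by rewrite Qs_cons /= ?(Qs0s, Qss0) /= addn0.
  rewrite [nseq n.+2 _]/= Qs_cons -/(nseq n.+1 0%N) IH /= ?(Qs0s, Qss0) /= addn0; ring.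
have WE x n : W ZFst x n = \sum_(i < n.+1) (-1) ^+ i * ZFst [:: (x + i)%N] * g (n - i)%N.
  elim: n x => [|n IH] x; first by rewrite big_ord1 /= addn0 mul1r ZFst_ones0 mulr1.
  have := QW ZFst x n; rewrite -ZFst_hom.2 // IH => /eqP.
  rewrite -subr_eq => /eqP <-; rewrite [RHS]big_ord_recl addn0 mul1r subn0.
  congr (_ + _); rewrite -sumrN; apply: eq_bigr => i _.
  by rewrite /= /bump add1n subSS addSnnS exprS; ring.
by rewrite -W0 WE; apply: eq_bigr => i _; rewrite add0n.
Qed.

(** The letter [i] is the entry i+1, so only even entries survive, and Newton's identities put
    [g n], n > 0, into the ideal of the even zeta values. *)
Lemma ZFst_letter i : ZFst [:: i] = (1 + (-1) ^+ i.+1) * Zst [:: i].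
Proof.
rewrite /ZFst conv_cons conv_nil /= /twist /wt /= addn0 addn1 !Zst_hom.1; ring.
Qed.

Section InductionStep.
Variable k : nat.

Definition ZFspan i := Qspan [set ZF l | l in [set l | wt l = i]].

Hypothesis IH : forall i, (i < k)%N -> forall d, Z i d -> ZFspan i d.

Let XQ : qsubspace (ZFspan k). Proof. exact: Qspan_sub. Qed.

Lemma ZF_in_span l : ZFspan (wt l) (ZF l).
Proof. by apply: Qspan_gen; exists l. Qed.

(** A convergent one-entry index multiplies each half of the convolution separately, through
    [Zs_adm]; the twist gives the second half its sign. *)
Lemma ZF_stuffle_letter i l : i != 0%N ->
  Qs st_op ZF [:: i] l = (1 + (-1) ^+ i.+1) * Zs [:: i] * ZF l.
Proof.
move=> i0; rewrite Qs_conv big_ord_recl big_ord1 -big_split mulr_sumr.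
apply: eq_bigr => j _; rewrite /= ?Qs0s Qs_twist.
have -> : Qs st_op (Zs \o rev) [:: i] (take j l) = Zs [:: i] * Zs (rev (take j l)).
  by rewrite -Qs_rev -[rev [:: i]]/[:: i] Zs_adm.
by rewrite Zs_adm // /twist exprD /= {1}/wt /= addn0 addn1; ring.
Qed.

Lemma even_zeta_span i d : odd i -> (i.+1 <= k)%N -> Z (k - i.+1)%N d ->
  ZFspan k (Zs [:: i] * d).
Proof.
move=> oi lek Zd; have ltk : (k - i.+1 < k)%N by lia.
apply: (Qspan_min (qsub_mull (Zs [:: i]) XQ) _ (IH ltk Zd)) => _ [l /= wl <-].
have i0 : i != 0%N by case: i oi {lek Zd ltk wl}.
apply: (@qsub_natdiv _ _ XQ 2) => //.
have -> : 2%:R * (Zs [:: i] * ZF l) = Qs st_op ZF [:: i] l.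
  by rewrite ZF_stuffle_letter // -signr_odd /= oi /=; ring.
apply: qsub_sum => // w /wt_qsh Ew _.
have -> : k = wt w by rewrite Ew wl /wt /=; lia.
exact: ZF_in_span.
Qed.

Lemma ZFst_ones_span n d : (0 < n)%N -> (n <= k)%N -> Z (k - n)%N d -> ZFspan k (g n * d).
Proof.
case: n => // n _ lek Zd; apply: (@qsub_natdiv _ _ XQ n.+1) => //.
rewrite mulrA ZFst_newton mulr_suml; apply: (qsub_sum XQ) => i _ _.
rewrite -!mulrA; apply: (qsub_sign XQ); rewrite ZFst_letter.
case oi: (odd i); last first.
  have [->|i0] := eqVneq (val i) 0%N.
    by rewrite Zst1 mulr0 mul0r; exact: (qsub0 XQ).
  by rewrite -signr_odd /= oi /= addrN !mul0r; exact: (qsub0 XQ).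
rewrite -signr_odd /= oi /= -mulrA; apply: (@qsub_natmul _ _ XQ 2).
rewrite Zst_adm; last by case: (val i) oi.
have lei := ltn_ord i; apply: even_zeta_span => //; first by lia.
have -> : (k - i.+1 = n - i + (k - n.+1))%N by lia.
by apply: ZM => //; apply: ZFst_ones_Z.
Qed.

(** Because [c] is inverse to [g], each [c n] with n > 0 is a combination of the [g j] with j >
    0. *)
Lemma ones_corr_span n d : (0 < n)%N -> (n <= k)%N -> Z (k - n)%N d -> ZFspan k (c n * d).
Proof.
case: n => // n _ lek Zd; have /eqP := ones_corr_inverse n.
rewrite big_ord_recl ZFst_ones0 mul1r subn0 addr_eq0 => /eqP ->.
rewrite mulNr mulr_suml; apply/(qsubN XQ)/(qsub_sum XQ) => i _ _.
rewrite -mulrA lift0; have lti := ltn_ord i; apply: ZFst_ones_span => //; first by lia.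
have -> : (k - i.+1 = n.+1 - i.+1 + (k - n.+1))%N by lia.
by apply: ZM => //; apply: ones_corr_Z.
Qed.

Lemma products_in_span i j p q : (0 < i)%N -> (0 < j)%N -> (i + j = k)%N ->
  Z i p -> Z j q -> ZFspan k (p * q).
Proof.
move=> i0 j0 ijk Zp Zq.
have ltik : (i < k)%N by lia.
have ltjk : (j < k)%N by lia.
apply: (Qspan_min (qsub_mulr q XQ) _ (IH ltik Zp)) => _ [u /= wu <-].
apply: (Qspan_min (qsub_mull (ZF u) XQ) _ (IH ltjk Zq)) => _ [v /= wv <-].
(* Exchanging [ZF] for [ZFst] in a product costs only multiples of [c n] with n > 0. The exchange is
   made in both factors, then undone in each word of the stuffle product. *)
have Yc r d : Z (wt r) d -> forall s, (wt s + wt r = k)%N -> ZFspan k ((ZF s - ZFst s) * d).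
  move=> Zd s sr; apply: (@ZF_ZFst (fun x => ZFspan k (x * d))) => [|n e n0 les Ze].
    exact: qsub_mulr.
  rewrite -mulrA; apply: ones_corr_span => //; first by lia.
  have -> : (k - n = wt s - n + wt r)%N by lia.
  exact: ZM.
apply: (qsub_congr XQ (b := ZFst u * ZF v)).
  by rewrite -mulrBl; apply: (Yc v) => //; [exact: ZF_Z|lia].
apply: (qsub_congr XQ (b := ZFst u * ZFst v)).
  by rewrite -mulrBr mulrC; apply: (Yc u) => //; [exact: ZFst_Z|lia].
rewrite ZFst_hom.2 //; apply: (qsub_sum XQ) => w /wt_qsh Ew _.
have wk : wt w = k by lia.
rewrite -[ZFst w]opprK -[- ZFst w](addKr (ZF w)) opprD opprK.
apply: (qsubB XQ); first by rewrite -wk; apply: ZF_in_span.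
rewrite -[ZF w - _]mulr1; apply: (Yc [::]) => //; last by rewrite addn0.
Qed.

End InductionStep.
End Products.

(** * Regularization *)

Section Asymptotics.
Variables (R : realType) (T : Type) (F : set_system T) (L : T -> R).
Context {FF : ProperFilter F}.
Hypothesis L_pinfty : L t @[t --> F] --> +oo.

(* Multiplying by arbitrary polynomials in [L] makes the relation stable under
   products. *)
Definition asymp (h : T -> R) (P : {poly R}) :=
  forall Q : {poly R}, (h t - P.[L t]) * Q.[L t] @[t --> F] --> (0 : R).

Lemma asymp_cvg h P : asymp h P -> h t - P.[L t] @[t --> F] --> (0 : R).
Proof.
by move=> /(_ 1%:P); under eq_fun do rewrite hornerC mulr1.
Qed.

Lemma eq_asymp h h' P : h =1 h' -> asymp h P -> asymp h' P.
Proof. by move=> /funext ->. Qed.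

Lemma asymp_poly P : asymp (fun t => P.[L t]) P.
Proof. by move=> Q; under eq_fun do rewrite subrr mul0r; apply: cvg_cst. Qed.

Lemma asympD h h' P P' : asymp h P -> asymp h' P' ->
  asymp (fun t => h t + h' t) (P + P').
Proof.
move=> hP hP' Q; rewrite -[0](addr0 0).
under eq_fun do rewrite hornerD opprD addrACA mulrDl.
by apply: cvgD.
Qed.

Lemma asympZ c h P : asymp h P -> asymp (fun t => c * h t) (c *: P).
Proof.
move=> hP Q; rewrite -(mulr0 c).
under eq_fun do rewrite hornerZ -mulrBr -mulrA.
by apply: cvgMr.
Qed.

Lemma asymp_sum (I : Type) (r : seq I) (h : I -> T -> R) (P : I -> {poly R}) :
  (forall i, asymp (h i) (P i)) ->
  asymp (fun t => \sum_(i <- r) h i t) (\sum_(i <- r) P i).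
Proof.
move=> hP; elim: r => [|i r IH].
  rewrite big_nil; apply: eq_asymp (asymp_poly 0) => t.
  by rewrite big_nil horner0.
rewrite big_cons; apply: eq_asymp (asympD (hP i) IH) => t.
by rewrite big_cons.
Qed.

Lemma asympM h h' P P' : asymp h P -> asymp h' P' ->
  asymp (fun t => h t * h' t) (P * P').
Proof.
move=> hP hP' Q.
have -> : (fun t => (h t * h' t - (P * P').[L t]) * Q.[L t]) =
  (fun t => (h t - P.[L t]) * ((h' t - P'.[L t]) * Q.[L t])
     + (h t - P.[L t]) * (P' * Q).[L t] + (h' t - P'.[L t]) * (P * Q).[L t]).
  by apply/funext => t; rewrite !hornerM; ring.
rewrite -[0]addr0; apply: cvgD => //.
rewrite -[0]addr0; apply: cvgD => //.
by rewrite -[0](mulr0 0); apply: cvgM => //; apply: asymp_cvg.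
Qed.

Lemma cvg_inv_pinfty : (L t)^-1 @[t --> F] --> (0 : R).
Proof.
apply/cvgr0Pnorm_lt => e e0.
have e1 : 0 < e^-1 by rewrite invr_gt0.
move/cvgryPgt: L_pinfty => /(_ e^-1); apply: filterS => t Lt.
have Lt0 : 0 < L t by apply: lt_trans Lt.
by rewrite normfV gtr0_norm // invf_plt // posrE.
Qed.

(** After subtraction of the constant term, division by [L] lowers the degree and preserves the
    limit 0. Uniqueness of regularization polynomials rests on this. *)
Lemma poly_cvg0 (P : {poly R}) : P.[L t] @[t --> F] --> (0 : R) -> P = 0.
Proof.
elim/poly_ind: P => // P c IH Pc.
suff P0 : P.[L t] @[t --> F] --> (0 : R).
  move: Pc; rewrite (IH P0) mul0r add0r; under eq_fun do rewrite hornerC.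
  by move=> c0; have /= <- := cvg_unique (@norm_hausdorff _ _) c0 (cvg_cst c).
have H : (L t)^-1 * ((P * 'X + c%:P).[L t] - c) @[t --> F] --> (0 : R).
  rewrite -(mul0r (0 - c)); apply: cvgM; first exact: cvg_inv_pinfty.
  by apply: cvgB => //; apply: cvg_cst.
apply: cvg_trans H; apply: near_eq_cvg.
move/cvgryPgt: L_pinfty => /(_ 0); apply: filterS => t Lt.
by rewrite !hornerE addrK mulrCA mulVf ?mulr1 // gt_eqF.
Qed.

Lemma asymp_unique h P P' : asymp h P -> asymp h P' -> P = P'.
Proof.
move=> /asymp_cvg hP /asymp_cvg hP'; apply/eqP; rewrite -subr_eq0; apply/eqP.
apply: poly_cvg0; rewrite -[0](subrr 0).
apply: cvg_trans (cvgB hP' hP); apply: near_eq_cvg; apply: nearW => t.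
rewrite !hornerE -[LHS]/((h t - P'.[L t]) - (h t - P.[L t])); ring.
Qed.

(** * Regularization of a multiplicative family, for both limits at once *)

Section Regularization.
Variables (A : eqType) (op : A -> A -> option A) (y : A) (V : pred (seq A)).
Variables (ev : seq A -> T -> R) (z : seq A -> R).
Hypothesis opy : forall c d, op y c = Some d -> d != y.
Hypotheses (V0 : V [::]) (Vy : V [:: y]) (V_qsh : qsh_closed op V).
Hypothesis V_behead : forall w, V (y :: w) -> V w.
Hypothesis ev_hom : forall t, is_hom op V (ev^~ t).
Hypothesis ev_y : forall t, ev [:: y] t = L t.
Hypothesis ev_conv : forall v, V v -> noy y v -> asymp (ev v) (z v)%:P.

(** The letter y has the polynomial ['X], and the product formula expresses the value at y^(m+1) v
    through values already expanded. *)
Lemma asymp_exists w : V w -> exists P, asymp (ev w) P.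
Proof.
move: w; apply: (@lead_rect_prop _ op y) => // [v Vv vy|m v vy Vm [P mP] H].
  by exists (z v)%:P; apply: ev_conv.
have m0 : m.+1%:R != 0 :> R by rewrite pnatr_eq0.
have [Pw PwE] : exists Pw, asymp (fun t => \sum_(w <- ins_rest op y m v) ev w t) Pw.
  elim: (ins_rest op y m v) H => [_|w s IH H].
    exists 0; apply: eq_asymp (asymp_poly 0) => t.
    by rewrite big_nil horner0.
  have [|Ps PsE] := IH; first by move=> w' w's; apply: H; rewrite inE w's orbT.
  have [_ [P1 P1E]] := H w (mem_head w s).
  exists (P1 + Ps); apply: eq_asymp (asympD P1E PsE) => t.
  by rewrite big_cons.
exists (m.+1%:R^-1 *: ('X * P + (-1) *: Pw)).
have XE : asymp (ev [:: y]) 'X.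
  by apply: eq_asymp (asymp_poly 'X) => t; rewrite hornerX ev_y.
apply: eq_asymp (asympZ _ (asympD (asympM XE mP) (asympZ (-1) PwE))) => t.
rewrite (ev_hom t).2 // Qs_ins mulN1r addrK mulrA mulVf // mul1r //.
Qed.

Definition regP w : {poly R} := xget 0 [set P | asymp (ev w) P].

Lemma regP_asymp w : V w -> asymp (ev w) (regP w).
Proof. by move=> /asymp_exists; rewrite /regP => -[P PE]; apply: xgetPex; exists P. Qed.

Lemma regP_eq w P : V w -> asymp (ev w) P -> regP w = P.
Proof. by move=> /regP_asymp; apply: asymp_unique. Qed.

Lemma regP_hom : is_hom op V regP.
Proof.
split=> [|u v Vu Vv].
  apply: regP_eq => //; apply: eq_asymp (asymp_poly 1) => t.
  by rewrite hornerC (ev_hom t).1.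
apply: asymp_unique (asympM (regP_asymp Vu) (regP_asymp Vv)) _.
suff H : asymp (fun t => \sum_(w <- [seq w <- qsh op u v | V w]) ev w t)
                 (\sum_(w <- [seq w <- qsh op u v | V w]) regP w).
  have E : all V (qsh op u v) by apply/allP => w; apply: V_qsh.
  move: H; rewrite (all_filterP E) => H.
  by apply: eq_asymp H => t; rewrite (ev_hom t).2.
elim: (qsh op u v) => [|w s IH] /=.
  by rewrite big_nil; apply: eq_asymp (asymp_poly 0) => t; rewrite big_nil horner0.
case: ifP => // Vw; rewrite big_cons.
by apply: eq_asymp (asympD (regP_asymp Vw) IH) => t; rewrite big_cons.
Qed.

Definition reg w : R := (regP w).[0].

Lemma reg_hom : is_hom op V reg.
Proof.
split=> [|u v Vu Vv]; first by rewrite /reg regP_hom.1 hornerC.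
by rewrite /reg -hornerM regP_hom.2 // /Qs horner_sum.
Qed.

Lemma reg_letter : reg [:: y] = 0.
Proof.
rewrite /reg (@regP_eq _ 'X) ?hornerX //.
by apply: eq_asymp (asymp_poly 'X) => t; rewrite hornerX ev_y.
Qed.

Lemma reg_conv v : V v -> noy y v -> reg v = z v.
Proof. by move=> Vv vy; rewrite /reg (regP_eq Vv (ev_conv Vv vy)) hornerC. Qed.

End Regularization.
End Asymptotics.

(** The default admits the empty word. Otherwise the innermost form must be dt/(1-t), so that the
    integral from 0 converges. *)
Definition valid (w : seq bool) := last true w.

Lemma valid_behead a w : valid (a :: w) -> valid w.
Proof. by case: w. Qed.

Lemma size_sh (A : eqType) (u v w : seq A) :
  w \in qsh (@sh_op A) u v -> size w = (size u + size v)%N.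
Proof.
move: u v w; apply: size_ind2 => [v w|u w|a u b v IH1 IH2 _ w].
- by rewrite qsh0s inE => /eqP ->.
- by rewrite qshs0 inE addn0 => /eqP ->.
by case/mem_qsh => [w' -> /IH1|w' -> /IH2|//] /= ->; rewrite ?addSn ?addnS.
Qed.

Lemma valid_sh : qsh_closed (@sh_op bool) valid.
Proof.
apply: size_ind2 => [v w _ vv|u w uv _|a u b v IH1 IH2 _ w uv vv].
- by rewrite qsh0s inE => /eqP ->.
- by rewrite qshs0 inE => /eqP ->.
case/mem_qsh => [w' ->|w' ->|//] w'uv.
  have := IH1 _ (valid_behead uv) vv w'uv.
  by case: w' w'uv => [/size_sh|//] /=; rewrite addnS.
have := IH2 _ uv (valid_behead vv) w'uv.
by case: w' w'uv => [/size_sh|//].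
Qed.

(** * Power series coefficients of iterated integrals *)

Section Coefficients.
Variable R : realFieldType.
Implicit Types s t : nat -> R.

(* The coefficient of [z^n] in the iterated integral of a word: [true] stands
   for the form [dt/(1-t)], [false] for [dt/t], and the head of the word is the
   outermost integration. At [n = 0] the factor [n^-1] is the junk value 0. *)
Fixpoint cf (w : seq bool) (n : nat) : R :=
  match w with
  | [::] => (n == 0%N)%:R
  | a :: w' => n%:R^-1 * (if a then \sum_(m < n) cf w' m else cf w' n)
  end.

Lemma cf_ge0 w n : 0 <= cf w n.
Proof.
elim: w n => [|a w IH] n /=; first by case: eqP.
apply: mulr_ge0; first by rewrite invr_ge0.
by case: a => //; apply: sumr_ge0.
Qed.

Lemma cf_le1 w n : cf w n <= 1.
Proof.
elim: w n => [|a w IH] [|n] //=; first by rewrite invr0 mul0r.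
rewrite ler_pdivrMl ?ltr0n // mulr1; case: a.
  apply: le_trans (_ : \sum_(m < n.+1) 1 <= _); first exact: ler_sum.
  by rewrite sumr_const card_ord.
by apply: (le_trans (IH _)); rewrite ler1n.
Qed.

Lemma cf_cons0 a w : cf (a :: w) 0 = 0.
Proof. by rewrite /= invr0 mul0r. Qed.

(** On power series this is multiplication by z/(1-z) or by 1, the effect of z d/dz on the outermost
    integration. *)
Definition tau (a : bool) s n := if a then \sum_(m < n) s m else s n.

Lemma cf_tau a w n : valid (a :: w) -> n%:R * cf (a :: w) n = tau a (cf w) n.
Proof.
case: n => [|n] vw; last by rewrite /= mulVKf // pnatr_eq0.
rewrite mul0r /tau; case: a vw; first by rewrite big_ord0.
by case: w => // b w _; rewrite cf_cons0.
Qed.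

Definition cconv s t n := \sum_(i < n.+1) s i * t (n - i)%N.

Lemma cconvC s t n : cconv s t n = cconv t s n.
Proof.
rewrite /cconv (reindex_inj rev_ord_inj) /=; apply: eq_bigr => i _.
by rewrite subSS subKn 1?mulrC // -ltnS.
Qed.

Lemma tau_cconv a s t n : cconv (tau a s) t n = tau a (cconv s t) n.
Proof.
case: a => //; have tauS f m : tau true f m.+1 = tau true f m + f m.
  exact: big_ord_recr.
elim: n => [|n IH]; first by rewrite /cconv big_ord1 /tau !big_ord0 mul0r.
rewrite [RHS]tauS -IH /cconv big_ord_recl {1}/tau big_ord0 mul0r add0r -big_split.
by apply: eq_bigr => i _; rewrite lift0 tauS subSS /= mulrDl.
Qed.

Lemma cconv_deriv s t n :
  n%:R * cconv s t n = cconv (fun i => i%:R * s i) t n + cconv s (fun i => i%:R * t i) n.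
Proof.
rewrite /cconv mulr_sumr -big_split; apply: eq_bigr => i _ /=.
by rewrite -{1}(@subnKC i n) -1?ltnS // natrD; ring.
Qed.

(** The Leibniz rule for z d/dz: differentiating a product of iterated integrals strips the
    outermost letter of one factor, as the shuffle recursion does. The coefficient at 0 is separate
    because multiplication by n loses it. *)
Lemma cf_cconv u v n : valid u -> valid v ->
  cconv (cf u) (cf v) n = Qs (@sh_op bool) (cf^~ n) u v.
Proof.
have cf0 w m : cconv (cf [::]) (cf w) m = cf w m.
  by rewrite /cconv big_ord_recl big1 ?addr0 ?mul1r ?subn0 // => i _; rewrite mul0r.
move: u v n; apply: size_ind2 => [v n _ _|u n _ _|a u b v IH1 IH2 _ n uv vv].
- by rewrite cf0 Qs0s.
- by rewrite cconvC cf0 Qss0.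
case: n => [|n].
  rewrite /cconv big_ord1 cf_cons0 mul0r Sh_cons.
  by rewrite !(@eq_Qs _ _ _ (_ \o cons _) (fun=> 0)) ?Qs0 ?addr0 //;
     move=> w; rewrite /= invr0 mul0r.
have n0 : n.+1%:R != 0 :> R by rewrite pnatr_eq0.
apply: (mulfI n0); rewrite cconv_deriv -QsZ Sh_cons.
have cE s s' t t' m : s =1 s' -> t =1 t' -> cconv s t m = cconv s' t' m.
  by move=> ss' tt'; apply: eq_bigr => i _; rewrite ss' tt'.
rewrite (cE _ (tau a (cf u)) _ (cf (b :: v))) //; last by move=> i; rewrite cf_tau.
rewrite (cE (cf (a :: u)) (cf (a :: u)) _ (tau b (cf v))) //;
  last by move=> i; rewrite cf_tau.
rewrite (cconvC _ (tau b _)) !tau_cconv.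
have QE c (s t : seq bool) : (forall m, cconv (cf s) (cf t) m = Qs (@sh_op bool) (cf^~ m) s t) ->
    (forall w, w \in qsh (@sh_op bool) s t -> valid (c :: w)) ->
    tau c (cconv (cf s) (cf t)) n.+1 =
    Qs (@sh_op bool) ((fun w => n.+1%:R * cf w n.+1) \o cons c) s t.
  move=> IH vw; rewrite (eq_in_Qs (g := fun w => tau c (cf w) n.+1)); last first.
    by move=> w /vw vcw; rewrite /comp cf_tau.
  rewrite /tau; case: c vw => vw; last by rewrite IH.
  by rewrite Qs_sum; apply: eq_bigr => i _; rewrite IH.
congr (_ + _).
  apply: QE => [m|w wuv]; first by apply: IH1 => //; apply: valid_behead uv.
  by apply: (valid_sh uv vv); rewrite qsh_cons !mem_cat map_f.
have sw m : cconv (cf v) (cf (a :: u)) m = cconv (cf (a :: u)) (cf v) m by apply: cconvC.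
rewrite (_ : tau b _ _ = tau b (cconv (cf (a :: u)) (cf v)) n.+1); last first.
  by rewrite /tau; case: (b) => //; apply: eq_bigr => i _; rewrite sw.
apply: QE => [m|w wuv]; first by apply: IH2 => //; apply: valid_behead vv.
by apply: (valid_sh uv vv); rewrite qsh_cons !mem_cat map_f ?orbT.
Qed.

End Coefficients.

(** * Series *)

Section NonnegativeSeries.
Variable R : realType.

Section Extended.
Local Open Scope ereal_scope.
Implicit Type g : nat -> \bar R.

Lemma nneseries_ltn g n : (forall i, 0 <= g i) ->
  \sum_(i <oo) (if (i < n)%N then g i else 0) = \sum_(i < n) g i.
Proof.
move=> g0; rewrite (nneseries_split 0 n); last by move=> k _; case: ifP.
rewrite add0n eseries0; last by move=> i ni _; rewrite ltnNge ni.
by rewrite adde0 big_mkord; apply: eq_bigr => i _; rewrite ltn_ord.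
Qed.

Lemma nneseries_shift g n : (forall i, 0 <= g i) ->
  \sum_(i <oo) (if (n <= i)%N then g (i - n)%N else 0) = \sum_(i <oo) g i.
Proof.
move=> g0; rewrite (nneseries_split 0 n); last by move=> k _; case: ifP.
rewrite add0n big_mkord big1 ?add0e; last by move=> i _; rewrite leqNgt ltn_ord.
rewrite -nneseries_addn; last by move=> i; case: ifP.
by apply: eq_eseriesr => i _; rewrite leq_addl addnK.
Qed.

(** [c] may be infinite: the Cauchy product takes for it the sum of the other series. *)
Lemma nneseriesZr g c : 0 <= c -> (forall i, 0 <= g i) ->
  \sum_(i <oo) (c * g i) = c * \sum_(i <oo) g i.
Proof.
move=> c0 g0; case: c c0 => [c c0||//]; first exact: nneseriesZl.
move=> _; have [G0|G0] := eqVneq (\sum_(i <oo) g i) 0.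
  rewrite G0 mule0 eseries0 // => i _ _.
  suff -> : g i = 0 by rewrite mule0.
  apply/eqP; rewrite eq_le g0 andbT -G0.
  by rewrite (@nneseriesD1 _ _ i) // leeDl // nneseries_ge0.
have [i gi] : exists i, g i != 0.
  apply: contrapT => /forallNP H; move: G0; rewrite eseries0 ?eqxx // => i _ _.
  by apply/eqP/negPn/negP; apply: H.
have gi0 : 0 < g i by rewrite lt_def gi g0.
rewrite [RHS]gt0_mulye; last by rewrite lt_def G0 nneseries_ge0.
apply: (@nneseries_pinfty _ _ _ i) => //; last exact: gt0_mulye.
by move=> n _; rewrite mule_ge0.
Qed.

Lemma nneseries_cauchy (f g : nat -> R) : (forall i, 0 <= f i)%R -> (forall i, 0 <= g i)%R ->
  \sum_(n <oo) (cconv f g n)%:E =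
  (\sum_(i <oo) (f i)%:E) * (\sum_(i <oo) (g i)%:E).
Proof.
move=> f0 g0.
transitivity (\sum_(n <oo) \sum_(i <oo)
    (if (i < n.+1)%N then (f i)%:E * (g (n - i)%N)%:E else 0)).
  apply: eq_eseriesr => n _; rewrite nneseries_ltn.
    by rewrite /cconv -sumEFin.
  by move=> i; rewrite mule_ge0 // lee_fin.
rewrite nneseries_interchange; last first.
  by move=> i j; case: ifP => // _; rewrite mule_ge0 // lee_fin.
transitivity (\sum_(i <oo) ((\sum_(j <oo) (g j)%:E) * (f i)%:E)).
  apply: eq_eseriesr => i _; rewrite muleC -nneseriesZr ?lee_fin //.
  rewrite -[RHS](nneseries_shift i); last by move=> j; rewrite mule_ge0 // lee_fin.
  by apply: eq_eseriesr => n _; rewrite ltnS.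
rewrite nneseriesZr; first by rewrite muleC.
  by apply: nneseries_ge0 => i _ _; rewrite lee_fin.
by move=> i; rewrite lee_fin.
Qed.
End Extended.

Implicit Type f g : nat -> R.

Definition nnsum f : R := fine (\sum_(n <oo) (f n)%:E)%E.
Definition summ f := (forall n, 0 <= f n) /\ (\sum_(n <oo) (f n)%:E < +oo)%E.

Lemma nnsumE f : summ f -> (\sum_(n <oo) (f n)%:E)%E = (nnsum f)%:E.
Proof.
move=> [f0 foo]; rewrite fineK // ge0_fin_numE //.
by apply: nneseries_ge0 => n _ _; rewrite lee_fin.
Qed.

Lemma nnsum_partial f n : summ f -> \sum_(i < n) f i <= nnsum f.
Proof.
move=> sf; rewrite -lee_fin -nnsumE // -sumEFin -(big_mkord xpredT (EFin \o f)).
by apply: nneseries_lim_ge => i _ _; rewrite lee_fin; apply: sf.1.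
Qed.

Lemma summ_bounded f C : (forall n, 0 <= f n) ->
  (forall n, \sum_(i < n) f i <= C) -> summ f /\ nnsum f <= C.
Proof.
move=> f0 fC.
have le : (\sum_(n <oo) (f n)%:E <= C%:E)%E.
  apply: lime_le; first by apply: is_cvg_nneseries => n _ _; rewrite lee_fin.
  by apply: nearW => n; rewrite big_mkord sumEFin lee_fin.
have sf : summ f by split=> //; apply: le_lt_trans le (ltry _).
by split=> //; rewrite -lee_fin -nnsumE.
Qed.

Lemma summ_ge0 f n : summ f -> 0 <= f n. Proof. by move=> sf; apply: sf.1. Qed.

Lemma nnsum_ge0 f : summ f -> 0 <= nnsum f.
Proof. by move=> sf; have := nnsum_partial 0 sf; rewrite big_ord0. Qed.

Lemma le_summ f g : (forall n, 0 <= f n <= g n) -> summ g -> summ f /\ nnsum f <= nnsum g.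
Proof.
move=> fg sg; apply: summ_bounded => n; first by case/andP: (fg n).
by apply: le_trans (nnsum_partial n sg); apply: ler_sum => i _; case/andP: (fg i).
Qed.

Lemma eq_nnsum f g : f =1 g -> nnsum f = nnsum g.
Proof. by move=> /funext ->. Qed.

Lemma summD f g : summ f -> summ g ->
  summ (fun n => f n + g n) /\ nnsum (fun n => f n + g n) = nnsum f + nnsum g.
Proof.
move=> sf sg.
have E : (\sum_(n <oo) (f n + g n)%:E = (nnsum f + nnsum g)%:E)%E.
  rewrite EFinD -!nnsumE // -nneseriesD // => n _ _; rewrite lee_fin;
  exact: summ_ge0.
split; last by rewrite /nnsum E.
by split=> [n|]; [rewrite addr_ge0 ?summ_ge0|rewrite E ltry].
Qed.

Lemma summZ c f : 0 <= c -> summ f ->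
  summ (fun n => c * f n) /\ nnsum (fun n => c * f n) = c * nnsum f.
Proof.
move=> c0 sf.
have E : (\sum_(n <oo) (c * f n)%:E = (c * nnsum f)%:E)%E.
  rewrite EFinM -!nnsumE // -nneseriesZl // => n _; rewrite lee_fin.
  exact: summ_ge0.
split; last by rewrite /nnsum E.
by split=> [n|]; [exact: mulr_ge0 c0 (summ_ge0 n sf)|rewrite E ltry].
Qed.

Lemma summ_sum (I : eqType) (r : seq I) (F : I -> nat -> R) :
  (forall i, i \in r -> summ (F i)) ->
  summ (fun n => \sum_(i <- r) F i n) /\
  nnsum (fun n => \sum_(i <- r) F i n) = \sum_(i <- r) nnsum (F i).
Proof.
elim: r => [|i r IH] H.
  have [||s0 le0] := @summ_bounded (fun=> 0) 0; [by []|by move=> n; rewrite big1|].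
  rewrite (_ : (fun _ => _) = (fun=> 0)); last by apply/funext => n; rewrite big_nil.
  by split=> //; apply/eqP; rewrite big_nil eq_le le0 nnsum_ge0.
have [|sr Er] := IH; first by move=> j jr; apply: H; rewrite inE jr orbT.
have [s' E'] := summD (H i (mem_head _ _)) sr.
rewrite (_ : (fun _ => _) = (fun n => F i n + \sum_(j <- r) F j n)); last first.
  by apply/funext => n; rewrite big_cons.
by rewrite big_cons -Er.
Qed.

Lemma summ_cauchy f g : summ f -> summ g ->
  summ (cconv f g) /\ nnsum (cconv f g) = nnsum f * nnsum g.
Proof.
move=> sf sg.
have E : (\sum_(n <oo) (cconv f g n)%:E = (nnsum f * nnsum g)%:E)%E.
  by rewrite nneseries_cauchy ?nnsumE //; move=> n; apply: summ_ge0.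
split; last by rewrite /nnsum E.
split=> [n|]; last by rewrite E ltry.
by apply: sumr_ge0 => i _; rewrite mulr_ge0 ?summ_ge0.
Qed.

Lemma summ_cvg f : summ f -> \sum_(i < n) f i @[n --> \oo] --> nnsum f.
Proof.
move=> sf.
have c : cvgn (series f) by apply: nnseries_is_cvg; [exact: sf.1|exact: sf.2].
have -> : (fun n => \sum_(i < n) f i) = series f.
  by apply/funext => n; rewrite /series /= big_mkord.
suff -> : nnsum f = limn (series f) by [].
apply: EFin_inj; rewrite -(nnsumE sf) -EFin_lim //; apply: congr_lim.
by apply/funext => n /=; rewrite /series /= sumEFin.
Qed.

Lemma summ_geometric (z : R) : 0 <= z < 1 ->
  summ (fun n => z ^+ n) /\ nnsum (fun n => z ^+ n) = (1 - z)^-1.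
Proof.
move=> /andP[z0 z1].
have nz : `|z| < 1 by rewrite ger0_norm.
have z1' : 0 < 1 - z by rewrite subr_gt0.
have [n||sz _] := @summ_bounded (fun n => z ^+ n) (1 - z)^-1.
- exact: exprn_ge0.
- move=> n; rewrite -[leRHS]mul1r ler_pdivlMr // mulrC.
  by rewrite -opprB mulNr -subrX1 opprB gerBl exprn_ge0.
split=> //; have := summ_cvg sz.
have -> : (fun n => \sum_(i < n) z ^+ i) = series (geometric 1 z).
  apply/funext => n; rewrite /series /= big_mkord.
  by apply: eq_bigr => i _; rewrite mul1r.
by move=> /cvg_lim <- //; rewrite (cvg_lim _ (cvg_geometric_series nz)) // mul1r.
Qed.

End NonnegativeSeries.

(** * Growth of the coefficients and speed of convergence *)

Section Estimates.
Variable R : realType.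
Local Notation cf := (@cf R).

Definition psum (w : seq bool) (N : nat) : R := \sum_(n < N.+1) cf w n.

Definition hsum (n : nat) : R := psum [:: true] n.

Lemma cf_true n : cf [:: true] n = n%:R^-1.
Proof.
case: n => [|n]; first by rewrite cf_cons0 invr0.
by rewrite /= big_ord_recl big1 ?addr0 ?mulr1.
Qed.

Lemma psumS w N : psum w N.+1 = psum w N + cf w N.+1.
Proof. by rewrite /psum big_ord_recr. Qed.

Lemma psum_ge0 w N : 0 <= psum w N.
Proof. by apply: sumr_ge0 => n _; apply: cf_ge0. Qed.

Lemma psum_homo w m n : (m <= n)%N -> psum w m <= psum w n.
Proof.
move=> /subnK <-; elim: (n - m)%N => // k IH.
by rewrite addSn psumS (le_trans IH) // lerDl cf_ge0.
Qed.

Lemma hsum0 : hsum 0 = 0.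
Proof. by rewrite /hsum /psum big_ord1 cf_cons0. Qed.

Lemma hsumS n : hsum n.+1 = hsum n + n.+1%:R^-1.
Proof. by rewrite /hsum psumS cf_true. Qed.

Lemma hsum_ge0 n : 0 <= hsum n. Proof. exact: psum_ge0. Qed.

Lemma hsum_ge1 n : (0 < n)%N -> 1 <= hsum n.
Proof.
move=> n0; apply: le_trans (psum_homo _ n0).
by rewrite -/(hsum 1) hsumS hsum0 add0r invr1.
Qed.

Lemma hsum_ge_inv n : n%:R^-1 <= hsum n.
Proof.
case: n => [|n]; first by rewrite invr0 hsum_ge0.
by apply: le_trans (hsum_ge1 _) => //; rewrite invf_le1 ?ltr0n // ler1n.
Qed.

(** Every further letter costs at most one harmonic number: [true] by summing 1/m, [false] because
    1/n is at most [hsum n]. *)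
Lemma cf_le_hsum w n : valid w -> w != [::] -> cf w n <= hsum n ^+ size w * n%:R^-1.
Proof.
elim: w n => // a w IH n vw _.
have [w0|w0] := eqVneq w [::].
  move: vw; rewrite w0; case: a => // _; rewrite cf_true expr1.
  case: n => [|n]; first by rewrite invr0 mulr0.
  by rewrite ler_peMl ?invr_ge0 // hsum_ge1.
have vw' := valid_behead vw.
rewrite [cf _ _]/= mulrC ler_wpM2r ?invr_ge0 //; case: a {vw} => /=.
  rewrite exprS; apply: le_trans (_ : \sum_(m < n) hsum n ^+ size w * m%:R^-1 <= _).
    apply: ler_sum => m _; apply: le_trans (IH m vw' w0) _.
    rewrite ler_wpM2r ?invr_ge0 // lerXn2r ?nnegrE ?hsum_ge0 //.
    by apply: psum_homo; apply: ltnW.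
  rewrite -mulr_sumr mulrC ler_wpM2r ?exprn_ge0 ?hsum_ge0 //.
  have -> : hsum n = \sum_(m < n) cf [:: true] m + cf [:: true] n.
    exact: big_ord_recr.
  apply: ler_wpDr; first exact: cf_ge0.
  by apply: ler_sum => m _; rewrite cf_true.
apply: le_trans (IH n vw' w0) _; rewrite exprSr ler_wpM2l ?exprn_ge0 ?hsum_ge0 //.
exact: hsum_ge_inv.
Qed.

Definition rs (n : nat) : R := (Num.sqrt n%:R)^-1.

Lemma rs_ge0 n : 0 <= rs n. Proof. by rewrite invr_ge0 sqrtr_ge0. Qed.

(** With a and b the roots of n and n+1, clearing denominators and multiplying by a + b leaves b (a
    + b) <= 4 a^2. The constant comes from a <= b and b^2 <= 2 a^2. *)
Lemma rs_diff n : (0 < n)%N -> n%:R^-1 * rs n <= 4 * (rs n - rs n.+1).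
Proof.
move=> n0; rewrite /rs; set a := Num.sqrt n%:R; set b := Num.sqrt n.+1%:R.
have a2 : a ^+ 2 = n%:R by rewrite sqr_sqrtr.
have b2 : b ^+ 2 = n%:R + 1 by rewrite sqr_sqrtr // natr1.
have n1 : 1 <= n%:R :> R by rewrite ler1n.
have a0 : 0 < a by rewrite sqrtr_gt0 ltr0n.
have b0 : 0 < b by rewrite sqrtr_gt0 ltr0n.
have ab : a <= b by rewrite ler_sqrt ?ler_nat.
rewrite -a2.
have -> : (a ^+ 2)^-1 * a^-1 = b * (a ^+ 3 * b)^-1 by field; rewrite !gt_eqF.
have -> : 4 * (a^-1 - b^-1) = 4 * a ^+ 2 * (b - a) * (a ^+ 3 * b)^-1.
  by field; rewrite !gt_eqF.
rewrite ler_wpM2r ?invr_ge0 ?mulr_ge0 ?exprn_ge0 ?(ltW a0) ?(ltW b0) //.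
have E : (b - a) * (b + a) = 1.
  by rewrite (_ : _ * _ = b ^+ 2 - a ^+ 2); [rewrite b2 a2; ring|ring].
have ba0 : 0 < b + a by rewrite addr_gt0.
rewrite -(ler_pM2r ba0) -[leRHS]mulrA E mulr1.
have : b ^+ 2 <= 2 * a ^+ 2 by rewrite b2 a2; lra.
have : a * b <= b ^+ 2 by rewrite expr2 ler_wpM2r // ltW.
nra.
Qed.

Lemma exprB_le (a b : R) m : 0 <= b -> b <= a ->
  a ^+ m.+1 - b ^+ m.+1 <= m.+1%:R * a ^+ m * (a - b).
Proof.
move=> b0 ba; have a0 : 0 <= a by apply: le_trans ba.
rewrite subrXX mulrC ler_wpM2r ?subr_ge0 //.
apply: le_trans (_ : \sum_(i < m.+1) a ^+ m <= _); last first.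
  by rewrite sumr_const card_ord mulr_natl.
apply: ler_sum => i _; rewrite -[in leRHS](@subnK i m) -1?ltnS // exprD.
by rewrite ler_wpM2l ?exprn_ge0 // lerXn2r ?nnegrE.
Qed.

Definition hq m n : R := hsum n ^+ m * (n%:R^-1 * rs n).

Lemma hq_sum0 N : \sum_(n < N.+1) hq 0 n + 4 * rs N.+1 <= 4.
Proof.
elim: N => [|N IH].
  by rewrite big_ord1 /hq invr0 mul0r mulr0 add0r /rs sqrtr1 invr1 mulr1.
have E : hq 0 N.+1 = N.+1%:R^-1 * rs N.+1 by rewrite /hq mul1r.
have L (S a b c : R) : S + 4 * b <= 4 -> a <= 4 * (b - c) -> S + a + 4 * c <= 4.
  by lra.
by rewrite big_ord_recr /= E; apply: L IH (@rs_diff N.+1 isT).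
Qed.

(** Summation by parts for H_n^(m+1) n^(-3/2), with [rs_diff] as telescoping majorant and [exprB_le]
    for the increments of H^(m+1). The boundary term is kept for the induction and is itself the
    source of [hsum_rs_bound]. *)
Lemma hq_sumS m N :
  \sum_(n < N.+1) hq m.+1 n + 4 * (hsum N ^+ m.+1 * rs N.+1)
  <= 4 * m.+1%:R * \sum_(n < N.+1) hq m n.
Proof.
elim: N => [|N IH].
  by rewrite !big_ord1 /hq hsum0 invr0 !expr0n /= !mul0r !mulr0 addr0.
rewrite big_ord_recr [in leRHS]big_ord_recr /= mulrDr.
have h0 := hsum_ge0 N; have h1 := hsum_ge0 N.+1.
have D : 0 <= hsum N.+1 ^+ m.+1 by apply: exprn_ge0.
have := ler_wpM2l D (@rs_diff N.+1 isT).
have le : hsum N <= hsum N.+1 by apply: psum_homo.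
have := ler_wpM2l (rs_ge0 N.+1) (exprB_le m h0 le).
have -> : hsum N.+1 - hsum N = N.+1%:R^-1 by rewrite hsumS addrC addKr.
have L (X Y Z r r' i S S' M : R) : r * (X - Y) <= r * (M * Z * i) ->
    X * (i * r) <= X * (4 * (r - r')) -> S + 4 * (Y * r) <= 4 * M * S' ->
    S + X * (i * r) + 4 * (X * r') <= 4 * M * S' + 4 * M * (Z * (i * r)).
  by nra.
by move=> H1 H2; apply: L H1 H2 IH.
Qed.

Lemma hq_bound m : exists K : R, forall N, \sum_(n < N) hq m n <= K.
Proof.
suff [K HK] : exists K : R, forall N, \sum_(n < N.+1) hq m n <= K.
  exists K => -[|N] //; rewrite big_ord0; apply: le_trans (HK 0%N).
  by apply: sumr_ge0 => n _; rewrite !mulr_ge0 ?exprn_ge0 ?hsum_ge0 ?invr_ge0 ?rs_ge0.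
elim: m => [|m [K HK]].
  exists 4 => N; apply: le_trans (hq_sum0 N); rewrite lerDl mulr_ge0 ?rs_ge0 //.
exists (4 * m.+1%:R * K) => N; apply: le_trans (ler_wpM2l _ (HK N)) => //.
apply: le_trans (hq_sumS m N); rewrite lerDl !mulr_ge0 ?exprn_ge0 ?hsum_ge0 ?rs_ge0 //.
Qed.

Lemma hsum_rs_bound m : exists K : R, forall N, hsum N ^+ m * rs N.+1 <= K.
Proof.
have rs1 N : rs N.+1 <= 1.
  have := hq_sum0 N; have : 0 <= \sum_(n < N.+1) hq 0 n.
    by apply: sumr_ge0 => n _; rewrite !mulr_ge0 ?exprn_ge0 ?hsum_ge0 ?invr_ge0 ?rs_ge0.
  lra.
case: m => [|m]; first by exists 1 => N; rewrite mul1r.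
have [K HK] := hq_bound m; exists (m.+1%:R * K) => N.
have := hq_sumS m N; have : 0 <= \sum_(n < N.+1) hq m.+1 n.
  by apply: sumr_ge0 => n _; rewrite !mulr_ge0 ?exprn_ge0 ?hsum_ge0 ?invr_ge0 ?rs_ge0.
have := ler_wpM2l (ler0n R m.+1) (HK N.+1); lra.
Qed.

(* Words [x ... y], i.e. those of convergent multiple zeta values. *)
Definition convergent (w : seq bool) := valid w && (if w is a :: _ then ~~ a else true).

(** The leading x gives a second factor 1/n, so the terms are dominated by [hq]. The spare sqrt n
    yields the power rates in [zt_tail] and [Li_zt]. *)
Lemma summ_sqrt w : convergent w -> w != [::] ->
  summ (fun n => cf w n * Num.sqrt n%:R).
Proof.
case: w => [|[] w] //; first by rewrite /convergent andbF.
move=> /andP[vw _] _.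
have w0 : w != [::] by case: w vw.
have [K HK] := hq_bound (size w).
have hq0 n : 0 <= hq (size w) n.
  by rewrite !mulr_ge0 ?exprn_ge0 ?hsum_ge0 ?invr_ge0 ?rs_ge0.
have [sq _] := summ_bounded hq0 HK.
apply: (proj1 (le_summ _ sq)) => n; rewrite mulr_ge0 ?cf_ge0 ?sqrtr_ge0 //=.
case: n => [|n]; first by rewrite invr0 !mul0r; apply: hq0.
have s2 : Num.sqrt n.+1%:R ^+ 2 = n.+1%:R :> R by rewrite sqr_sqrtr.
have s0 : Num.sqrt n.+1%:R != 0 :> R by rewrite gt_eqF // sqrtr_gt0 ltr0n.
have n0 : n.+1%:R != 0 :> R by rewrite pnatr_eq0.
apply: le_trans (_ : n.+1%:R^-1 * (hsum n.+1 ^+ size w * n.+1%:R^-1) * Num.sqrt n.+1%:R <= _).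
  rewrite ler_wpM2r ?sqrtr_ge0 // ler_wpM2l ?invr_ge0 //.
  exact: cf_le_hsum (valid_behead vw) w0.
rewrite /hq /rs (_ : (Num.sqrt n.+1%:R)^-1 = Num.sqrt n.+1%:R / n.+1%:R).
  by rewrite le_eqVlt; apply/orP; left; apply/eqP; ring.
by rewrite -{3}s2 expr2 invfM mulrA mulfV // mul1r.
Qed.

Lemma sqrt_ge1 n : (0 < n)%N -> 1 <= Num.sqrt n%:R :> R.
Proof. by move=> n0; rewrite -[leLHS]sqrtr1 ler_sqrt ?ler1n. Qed.

Lemma summ_cf w : convergent w -> summ (cf w).
Proof.
have [->|w0] := eqVneq w [::].
  move=> _; have [|n|//] := @summ_bounded _ (cf [::]) 1.
    by move=> n; apply: cf_ge0.
  case: n => [|n]; first by rewrite big_ord0.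
  by rewrite big_ord_recl /= big1 // addr0.
move=> cw; apply: (proj1 (le_summ _ (summ_sqrt cw w0))) => n; rewrite cf_ge0 /=.
case: n => [|n]; first by case: w {cw} w0 => // a w _; rewrite cf_cons0 mul0r.
by rewrite ler_peMr ?cf_ge0 // sqrt_ge1.
Qed.

Definition zt w : R := nnsum (cf w).

(** Beyond [N] the factor [rs N.+1] times sqrt n is at least 1, so the tail is bounded by the sum
    from [summ_sqrt]. *)
Lemma zt_tail w : convergent w -> exists C : R, forall N,
  0 <= zt w - psum w N <= C * rs N.+1.
Proof.
move=> cw; have sw := summ_cf cw.
have [w0|w0] := eqVneq w [::].
  exists 0 => N; rewrite mul0r.
  have := nnsum_partial N.+1 sw; have : zt w <= 1.
    have [|n|//] := @summ_bounded _ (cf w) 1; first by move=> n; apply: cf_ge0.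
    rewrite w0; case: n => [|n]; first by rewrite big_ord0.
    by rewrite big_ord_recl /= big1 // addr0.
  rewrite /psum /zt; suff -> : \sum_(i < N.+1) cf w i = 1 by lra.
  by rewrite w0 big_ord_recl /= big1 // addr0.
have ss := summ_sqrt cw w0; exists (nnsum (fun n => cf w n * Num.sqrt n%:R)) => N.
apply/andP; split; first by rewrite subr_ge0; apply: nnsum_partial.
pose f n := if (n < N.+1)%N then cf w n else 0.
have r0 : 0 < Num.sqrt N.+1%:R :> R by rewrite sqrtr_gt0 ltr0n.
have [||sf fle] := @summ_bounded _ f (psum w N).
- by move=> n; rewrite /f; case: ifP => // _; apply: cf_ge0.
- move=> n; rewrite /f -big_mkcond /=.
  have [le|gt] := leqP n N.+1.
    rewrite (eq_bigl xpredT); last by move=> i; rewrite (leq_trans (ltn_ord i)).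
    by rewrite /psum !(big_ord_widen _ _ le) [leRHS](bigID (fun i : 'I_N.+1 => (i < n)%N)) /=
       lerDl sumr_ge0 // => i _; apply: cf_ge0.
  by rewrite /psum (big_ord_widen _ _ (ltnW gt)).
have [sg gE] := summZ (rs_ge0 N.+1) ss; have [st tE] := summD sf sg.
rewrite lerBlDl [_ * rs _]mulrC -gE; apply: (@le_trans _ _ (nnsum f +
  nnsum (fun n => rs N.+1 * (cf w n * Num.sqrt n%:R)))); last by rewrite lerD2r.
rewrite -tE; apply: (proj2 (le_summ _ st)) => n; rewrite cf_ge0 /= /f.
have [lt|ge] := ltnP n N.+1; first by rewrite lerDl !mulr_ge0 ?rs_ge0 ?cf_ge0 ?sqrtr_ge0.
rewrite add0r mulrCA ler_peMr ?cf_ge0 // /rs mulrC ler_pdivlMr // mul1r.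
by rewrite ler_sqrt ?ler_nat.
Qed.

End Estimates.

Lemma asymp_const (R : realType) (T : Type) (F : set_system T) {FF : ProperFilter F}
    (L h : T -> R) (c : R) : L t @[t --> F] --> +oo ->
  (forall j, exists K, \forall t \near F, `|h t - c| * L t ^+ j <= K) ->
  asymp F L h c%:P.
Proof.
move=> Ly H Q.
have Hj j : (h t - c) * L t ^+ j @[t --> F] --> (0 : R).
  (* One power of [L] more than required: boundedness at [j.+1] gives a bound [K] / [L] at [j]. *)
  have [K KE] := H j.+1; apply/cvgr0Pnorm_lt => e e0.
  have K0 : 0 <= `|K| by [].
  near=> t.
  have Lt : `|K| / e < L t by near: t; move/cvgryPgt: Ly; apply.
  have Kt : `|h t - c| * L t ^+ j.+1 <= K by near: t.
  have Lt0 : 0 < L t by apply: le_lt_trans Lt; rewrite divr_ge0 // ltW.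
  rewrite normrM (ger0_norm (exprn_ge0 j (ltW Lt0))) -(ltr_pM2r Lt0) -mulrA -exprSr.
  apply: le_lt_trans Kt _; apply: le_lt_trans (ler_norm K) _.
  by rewrite mulrC -ltr_pdivrMr.
under eq_fun do rewrite hornerC.
suff G (e : T -> R) : (forall j, e t * L t ^+ j @[t --> F] --> (0 : R)) ->
    e t * Q.[L t] @[t --> F] --> (0 : R) by exact: (G (fun t => h t - c)).
elim/poly_ind: Q e {Hj} => [|P d IH] e Hj.
  by under eq_fun do rewrite horner0 mulr0; apply: cvg_cst.
have E : (fun t => e t * (P * 'X + d%:P).[L t]) =
    (fun t => (e t * L t) * P.[L t] + d * (e t * L t ^+ 0)).
  by apply/funext => t; rewrite hornerD hornerMX hornerC expr0; ring.
rewrite E -[0](addr0 0); apply: cvgD.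
  by apply: IH => j; under eq_fun do rewrite -mulrA -exprS; apply: Hj.
by rewrite -(mulr0 d); apply: cvgMr; apply: Hj.
Unshelve. all: by end_near. Qed.

Fixpoint enc (r : seq nat) : seq bool :=
  if r is a :: r' then nseq a false ++ true :: enc r' else [::].

Lemma valid_enc r : valid (enc r).
Proof.
by case: r => // a r; rewrite /valid /= last_cat /=; elim: r => //= b r; rewrite last_cat.
Qed.

Lemma enc_onto w : valid w -> exists r, w = enc r.
Proof.
have [n] := ubnP (size w); elim: n w => // n IH [|a w] lt vw; first by exists [::].
have [r wE] := IH w lt (valid_behead vw); case: a {lt} vw => [_|vw].
  by exists (0%N :: r); rewrite wE.
by case: r wE => [E|b r E]; [rewrite E in vw|exists (b.+1 :: r); rewrite E].
Qed.

Lemma size_enc r : size (enc r) = wt r.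
Proof. by elim: r => //= a r IH; rewrite size_cat size_nseq /= IH wt_cons addnS addSn. Qed.

Lemma convergent_enc r : convergent (enc r) = noy 0%N r.
Proof. by rewrite /convergent valid_enc; case: r => // -[]. Qed.

(** * Truncated sums and polylogarithms *)

Section Polylogarithms.
Variable R : realType.
Local Notation cf := (@cf R).
Local Notation psum := (@psum R).
Local Notation zt := (@zt R).

Lemma cf_enc_cons a r n :
  cf (enc (a :: r)) n = n%:R ^- a.+1 * \sum_(m < n) cf (enc r) m.
Proof.
rewrite /=; elim: a => [|a IH] //=.
by rewrite IH [in RHS]exprS invfM mulrA.
Qed.

(** The multiple harmonic sum whose largest variable is at most [N]. *)
Definition HN (r : seq nat) (N : nat) : R := psum (enc r) N.

Lemma HN_nil N : HN [::] N = 1.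
Proof. by rewrite /HN /psum big_ord_recl big1 ?addr0. Qed.

Lemma HN_cons0 a r : HN (a :: r) 0 = 0.
Proof. by rewrite /HN /psum big_ord1 cf_enc_cons big_ord0 mulr0. Qed.

Lemma HN_consS a r N :
  HN (a :: r) N.+1 = HN (a :: r) N + N.+1%:R ^- a.+1 * HN r N.
Proof. by rewrite /HN psumS cf_enc_cons. Qed.

(** The step from N to N+1 is the product rule for finite differences; the term in which both
    factors jump is the contracted letter. *)
Lemma HN_hom N : is_hom st_op predT (HN^~ N).
Proof.
split=> [|u v _ _]; first exact: HN_nil.
move: u v N; apply: size_ind2 => [v N|u N|a u b v IH1 IH2 IH3 N].
- by rewrite HN_nil mul1r Qs0s.
- by rewrite HN_nil mulr1 Qss0.
elim: N => [|N IHN].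
  rewrite HN_cons0 mul0r Qs_cons /=.
  rewrite !(@eq_Qs _ _ _ (_ \o cons _) (fun=> 0)) ?Qs0 ?addr0 //;
    by move=> w; rewrite /= HN_cons0.
have E c s t : Qs st_op ((HN^~ N.+1) \o cons c) s t =
   Qs st_op ((HN^~ N) \o cons c) s t + N.+1%:R ^- c.+1 * Qs st_op (HN^~ N) s t.
  by rewrite -QsZ -QsD; apply: eq_Qs => w /=; rewrite HN_consS.
rewrite Qs_cons /= in IHN; rewrite Qs_cons /= !E -IH1 -IH2 -IH3 !HN_consS.
pose x : R := N.+1%:R^-1; have xE c : N.+1%:R ^- c = x ^+ c by rewrite /x exprVn.
have xab : x ^+ (a + b).+2 = x ^+ a.+1 * x ^+ b.+1 by rewrite -exprD addSn addnS.
rewrite !mulrDl !mulrDr IHN !xE xab; ring.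
Qed.

Definition Li (w : seq bool) (z : R) : R := nnsum (fun n => z ^+ n * cf w n).

Lemma Li_summ w z : 0 <= z < 1 -> summ (fun n => z ^+ n * cf w n).
Proof.
move=> z01; apply: (proj1 (le_summ _ (proj1 (summ_geometric z01)))) => n.
case/andP: z01 => z0 _.
by rewrite mulr_ge0 ?exprn_ge0 ?cf_ge0 //= ler_piMr ?exprn_ge0 ?cf_le1.
Qed.

Lemma Li_hom z : 0 <= z < 1 -> is_hom (@sh_op bool) valid (Li^~ z).
Proof.
move=> z01; split=> [|u v vu vv].
  rewrite /Li (eq_nnsum (g := cf [::])); last first.
    by case=> [|n]; rewrite /= ?expr0 ?mul1r ?mulr0.
  have [|n|s le1] := @summ_bounded _ (cf [::]) 1; first by move=> n; apply: cf_ge0.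
    case: n => [|n]; first by rewrite big_ord0.
    by rewrite big_ord_recl /= big1 // addr0.
  apply/eqP; rewrite eq_le le1 /=; apply: le_trans (nnsum_partial 1 s).
  by rewrite big_ord1.
have [_ <-] := summ_cauchy (Li_summ u z01) (Li_summ v z01).
have [|_ E] := @summ_sum _ _ (qsh (@sh_op bool) u v) (fun w n => z ^+ n * cf w n).
  by move=> w _; apply: Li_summ.
apply: (etrans _ E); apply: eq_nnsum => n; rewrite -mulr_sumr -/(Qs (@sh_op bool) (cf^~ n) u v) -cf_cconv //.
rewrite /cconv mulr_sumr; apply: eq_bigr => i _.
have -> : z ^+ n = z ^+ i * z ^+ (n - i) by rewrite -exprD subnKC // -ltnS.
by ring.
Qed.

(** Multiplication by the geometric series turns coefficients into truncated sums, through which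
    stuffle relations reach polylogarithms. *)
Lemma Li_psum w z : 0 <= z < 1 ->
  summ (fun N => z ^+ N * psum w N) /\
  Li w z = (1 - z) * nnsum (fun N => z ^+ N * psum w N).
Proof.
move=> z01; have [sg gE] := summ_geometric z01.
have [sc cE] := summ_cauchy (Li_summ w z01) sg.
have E N : cconv (fun n => z ^+ n * cf w n) (fun n => z ^+ n) N = z ^+ N * psum w N.
  rewrite /cconv mulr_sumr; apply: eq_bigr => i _.
  have -> : z ^+ N = z ^+ i * z ^+ (N - i) by rewrite -exprD subnKC // -ltnS.
  by ring.
rewrite -(funext E); split=> //; rewrite cE gE mulrC divfK //.
by case/andP: z01 => _ z1; rewrite gt_eqF // subr_gt0.
Qed.

Lemma Li_zt w : convergent w -> exists C : R, forall z, 0 <= z < 1 ->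
  `|Li w z - zt w| <= C * Num.sqrt (1 - z).
Proof.
move=> cw; have sw := summ_cf R cw.
have [w0|w0] := eqVneq w [::].
  exists 0 => z z01; rewrite mul0r w0 (Li_hom z01).1.
  suff -> : zt [::] = 1 by rewrite subrr normr0.
  have z00 : ((0 : R) <= 0) && ((0 : R) < 1) by rewrite lexx ltr01.
  rewrite -(Li_hom z00).1; apply: eq_nnsum => n.
  by rewrite expr0n; case: n => [|n]; rewrite ?mul1r // mul0r.
have ss := summ_sqrt R cw w0; exists (nnsum (fun n => cf w n * Num.sqrt n%:R)) => z z01.
have [z0 z1] := andP z01.
have [sc cE] := summZ (sqrtr_ge0 (1 - z)) ss.
have sL := Li_summ w z01; have [st tE] := summD sL sc.
have zn n : z ^+ n <= 1 by rewrite exprn_ile1 // ltW.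
have [_ le1] : summ (fun n => z ^+ n * cf w n) /\ Li w z <= zt w.
  apply: le_summ sw => n; rewrite mulr_ge0 ?exprn_ge0 ?cf_ge0 //=.
  by rewrite ler_piMl ?cf_ge0.
rewrite distrC ger0_norm ?subr_ge0 // lerBlDl mulrC -cE -tE.
apply: (proj2 (le_summ _ st)) => n; rewrite cf_ge0 /=.
(* The left side is at most 1 and at most n (1 - z), hence its square is at most n (1 - z). *)
suff key : 1 - z ^+ n <= Num.sqrt (1 - z) * Num.sqrt n%:R.
  have key' : 0 <= Num.sqrt (1 - z) * Num.sqrt n%:R - (1 - z ^+ n) by rewrite subr_ge0.
  rewrite -subr_ge0; have := mulr_ge0 (cf_ge0 R w n) key'.
  by congr (0 <= _); ring.
have z1' : 0 <= 1 - z by rewrite subr_ge0 ltW.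
rewrite -sqrtrM //.
have le0 : 0 <= 1 - z ^+ n by rewrite subr_ge0.
rewrite -[leLHS]ger0_norm // -sqrtr_sqr ler_sqrt ?mulr_ge0 //.
apply: le_trans (_ : 1 - z ^+ n <= _).
  by rewrite expr2 ler_piMr // lerBlDl lerDr exprn_ge0.
rewrite -opprB subrX1 -mulNr opprB ler_wpM2l //.
apply: le_trans (_ : \sum_(i < n) 1 <= _); last by rewrite sumr_const card_ord.
by apply: ler_sum => i _.
Qed.

Lemma abel_null (s : nat -> R) : (forall n, 0 <= s n) -> s n @[n --> \oo] --> (0 : R) ->
  (1 - z) * nnsum (fun N => z ^+ N * s N) @[z --> 1^'-] --> (0 : R).
Proof.
move=> s0 sc; have [M MP] : exists M, forall n, s n <= M.
  have /cvg_seq_bounded[M [_ MP]] : cvgn s by apply/cvg_ex; exists 0.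
  exists (M + 1) => n; apply: le_trans (ler_norm _) _.
  by apply: MP => //; rewrite ltrDl.
have M0 : 0 <= M by apply: le_trans (MP 0%N).
apply/cvgr0Pnorm_le => e e0.
have e2 : 0 < e / 2 by rewrite divr_gt0.
have [N _ NP] : \forall n \near \oo, s n <= e / 2.
  move/cvgr0Pnorm_le: sc => /(_ _ e2); apply: filterS => n.
  by rewrite ger0_norm.
(* For 1 - z <= d the first [N] terms, each at most [M], contribute at most e/2; the added 1 keeps
   the denominator positive. *)
pose d := e / 2 / (N%:R * M + 1).
have NM1 : 0 < N%:R * M + 1 by rewrite ltr_wpDl // mulr_ge0.
have d0 : 0 < d by rewrite divr_gt0.
have d1 : 1 - d < 1 by rewrite ltrBlDr ltrDl.
near=> z.
have z0 : 0 < z by near: z; apply: nbhs_left_gt.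
have z1 : z < 1 by near: z; apply: nbhs_left_lt.
have zM : 1 - z <= d.
  suff : 1 - d <= z by rewrite lerBlDr -lerBlDl.
  by near: z; apply: nbhs_left_ge.
have z01 : 0 <= z < 1 by rewrite ltW.
have [sg gE] := summ_geometric z01.
have [se eE] := summZ (ltW e2) sg.
pose f n := if (n < N)%N then M else 0.
have [||sf fle] := @summ_bounded _ f (N%:R * M).
- by move=> n; rewrite /f; case: ifP.
- move=> n; suff -> : \sum_(i < n) f i = (minn n N)%:R * M.
    by rewrite ler_wpM2r // ler_nat geq_minr.
  elim: n => [|n IH]; first by rewrite big_ord0 min0n mul0r.
  rewrite big_ord_recr /= IH /f; case: ltnP => nN.
    by rewrite !(minn_idPl _) // 1?ltnW // -natr1 mulrDl mul1r.
  by rewrite !(minn_idPr _) ?addr0 // (leq_trans nN).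
have [st tE] := summD se sf.
have [ss sle] : summ (fun n => z ^+ n * s n) /\ nnsum (fun n => z ^+ n * s n) <= nnsum (fun n => e / 2 * z ^+ n + f n).
  apply: le_summ st => n; rewrite mulr_ge0 ?exprn_ge0 ?s0 ?(ltW z0) //= /f.
  case: ltnP => [lt|ge].
    apply: (@le_trans _ _ M); last by rewrite lerDr mulr_ge0 ?exprn_ge0 // ltW.
    by apply: le_trans (MP n); rewrite ler_piMl // exprn_ile1 // ltW.
  rewrite addr0 mulrC ler_wpM2r ?exprn_ge0 ?(ltW z0) //; exact: NP.
have z1' : 0 < 1 - z by rewrite subr_gt0.
rewrite ger0_norm ?mulr_ge0 ?nnsum_ge0 ?(ltW z1') //.
apply: le_trans (ler_wpM2l (ltW z1') sle) _; rewrite tE eE gE mulrDr mulrCA mulfV ?gt_eqF // mulr1.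
rewrite [leRHS](splitr e) lerD2l.
apply: le_trans (ler_wpM2l (ltW z1') fle) _.
have NM : 0 <= N%:R * M by rewrite mulr_ge0.
move: zM; rewrite ler_pdivlMr // mulrDr mulr1; apply: le_trans.
by rewrite lerDl ltW.
Unshelve. all: by end_near. Qed.

End Polylogarithms.

(** * The polylogarithm of y is a logarithm *)

Section Logarithm.
Variable R : realType.

Let c (n : nat) : R := n%:R^-1.

Lemma summ_pseries (d : nat -> R) (z : R) : summ (fun n => d n * z ^+ n) ->
  cvgn (pseries d z) /\ limn (pseries d z) = nnsum (fun n => d n * z ^+ n).
Proof.
move=> /summ_cvg; rewrite (_ : (fun n => \sum_(i < n) _) = pseries d z).
  by move=> H; split; [apply: cvgP H|apply: cvg_lim H].
by apply/funext => n; rewrite /pseries /series /= big_mkord.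
Qed.

Lemma pseries_log_deriv (x : R) : 0 <= x < 1 ->
  is_derive x (1 : R) (fun y => limn (pseries c y)) (1 - x)^-1.
Proof.
(* A point strictly between [x] and 1, at which the series and its first two formal derivatives
   converge. *)
move=> x01; have [x0 x1] := andP x01; pose K := (1 + x) / 2.
have K01 : 0 <= K < 1 by apply/andP; split; rewrite /K; lra.
have K0 := (andP K01).1; have xK : x < K by rewrite /K; lra.
have [sg gE] := summ_geometric K01.
have [s2 _] := summ_cauchy sg sg.
have d1 : pseries_diffs c = fun=> 1.
  by apply/funext => i; rewrite /pseries_diffs /c mulfV ?pnatr_eq0.
have d2 : pseries_diffs (fun=> 1 : R) = fun i => i.+1%:R.
  by apply/funext => i; rewrite /pseries_diffs mulr1.
have s1 (y : R) : 0 <= y < 1 -> summ (fun n => (1 : R) * y ^+ n).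
  by move=> /summ_geometric[]; under [X in _ -> _ -> summ X]eq_fun do rewrite mul1r.
have sc : summ (fun n => c n * K ^+ n).
  apply: (proj1 (le_summ _ (s1 K K01))) => n; rewrite mulr_ge0 ?invr_ge0 ?exprn_ge0 ?K0 //=.
  rewrite ler_wpM2r ?exprn_ge0 ?K0 //.
  by case: n => [|n]; rewrite /c ?invr0 // invf_le1 ?ltr0n // ler1n.
have := @pseries_snd_diffs R c K x (summ_pseries sc).1.
rewrite d1 d2 (summ_pseries (s1 x x01)).2.
have -> : nnsum (fun n => (1 : R) * x ^+ n) = (1 - x)^-1.
  by rewrite -(summ_geometric x01).2; apply: eq_nnsum => n; rewrite mul1r.
apply; first exact: (summ_pseries (s1 K K01)).1.
  apply: (summ_pseries (d := fun i => i.+1%:R) _).1.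
  rewrite (_ : (fun n => _) = cconv (fun n => K ^+ n) (fun n => K ^+ n)) //.
  apply/funext => n; rewrite /cconv.
  rewrite (eq_bigr (fun=> K ^+ n)) ?sumr_const ?card_ord ?mulr_natl // => i _.
  by rewrite -exprD subnKC // -ltnS.
by rewrite !ger0_norm.
Qed.

Lemma Li_log (z : R) : 0 <= z < 1 -> Li [:: true] z = - ln (1 - z).
Proof.
move=> z01; have [z0 z1] := andP z01.
have LE (y : R) : 0 <= y < 1 -> limn (pseries c y) = Li [:: true] y.
  move=> y01; have E : (fun n => y ^+ n * cf R [:: true] n) = fun n => c n * y ^+ n.
    by apply/funext => n; rewrite cf_true mulrC.
  by rewrite /Li E (summ_pseries _).2 // -E; apply: Li_summ.
pose F (y : R) := limn (pseries c y) + ln (1 - y).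
have dF (y : R) : 0 <= y < 1 -> is_derive y (1 : R) F 0.
  move=> y01; have [_ y1] := andP y01.
  have dl : is_derive y (1 : R) (fun y => ln (1 - y)) (- (1 - y)^-1).
    have y1' : 0 < 1 - y by rewrite subr_gt0.
    have H : is_derive y (1 : R) (fun y => 1 - y) (-1).
      by apply: trigger_derive; rewrite add0r mul1r.
    have := @is_derive1_comp R (@ln R) (fun y => 1 - y) y _ _ (is_derive1_ln y1') H.
    by rewrite mulrN1.
  rewrite -(subrr (1 - y)^-1); exact: is_deriveD (pseries_log_deriv y01) dl.
have [||u _] := @MVT_segment R F (fun=> 0) 0 z z0.
- by move=> x; rewrite in_itv /= => /andP[x0 xz]; apply: dF; rewrite ltW //= (lt_trans xz).
- apply: derivable_within_continuous => x; rewrite in_itv /= => /andP[x0 xz].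
  by have := dF x; rewrite x0 (le_lt_trans xz z1) => /(_ isT)[].
rewrite mul0r /F !LE // ?lexx ?ltr01 // subr0 ln1 addr0.
have -> : Li [:: true] (0 : R) = 0.
  rewrite /Li; have := @summ_bounded R (fun n => 0 ^+ n * cf R [:: true] n) 0.
  have E n : 0 ^+ n * cf R [:: true] n = 0.
    by case: n => [|n]; [rewrite cf_cons0 mulr0|rewrite expr0n mul0r].
  case=> [n|n|s le0]; rewrite ?E ?big1 //.
  by apply/eqP; rewrite eq_le le0 nnsum_ge0.
by rewrite subr0 => /eqP; rewrite addr_eq0 => /eqP.
Qed.

End Logarithm.

(** * Shuffle and stuffle regularized values and their relation *)

Section RegularizedValues.
Variable R : realType.
Local Notation zt := (@zt R).

(* Clipping to ]0, 1[ makes the algebraic identities hold at every point. *)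
Definition clip (z : R) : R := if (0 < z) && (z < 1) then z else 2^-1.
Definition logv (z : R) : R := - ln (1 - clip z).
Definition Lic (w : seq bool) (z : R) : R := Li w (clip z).

Lemma clip01 z : 0 <= clip z < 1.
Proof.
rewrite /clip; case: ifP => [/andP[z0 z1]|_]; first by rewrite ltW.
by rewrite invr_ge0 ler0n invf_lt1 // ltr1n.
Qed.

Lemma clip_id z : 0 < z < 1 -> clip z = z.
Proof. by rewrite /clip => ->. Qed.

Lemma near_clip : \forall z \near (1 : R)^'-, 0 < z < 1.
Proof.
near=> z; apply/andP; split; near: z; [exact: nbhs_left_gt|exact: nbhs_left_lt].
Unshelve. all: by end_near. Qed.

Lemma logv_pinfty : logv z @[z --> 1^'-] --> +oo.
Proof.
apply/cvgryPge => M; have e0 : 1 - expR (- M) < 1 by rewrite ltrBlDr ltrDl expR_gt0.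
near=> z; have z01 : 0 < z < 1 by near: z; exact: near_clip.
have [z0 z1] := andP z01.
rewrite /logv clip_id // lerNr -[leRHS]expRK ler_ln ?posrE ?expR_gt0 ?subr_gt0 //.
rewrite lerBlDr -lerBlDl; near: z; exact: nbhs_left_ge.
Unshelve. all: by end_near. Qed.

(** The root is exp(-L/2) with L = [logv z], and (L/2)^j is at most j! exp(L/2). *)
Lemma sqrt_log_bound j z : Num.sqrt (1 - clip z) * logv z ^+ j <= 2 ^+ j * j`!%:R.
Proof.
have [z0 z1] := andP (clip01 z).
have s0 : 0 <= logv z by rewrite /logv oppr_ge0 ln_le0 // lerBlDr lerDl.
have z1' : 0 < 1 - clip z by rewrite subr_gt0.
have E : Num.sqrt (1 - clip z) = (expR (logv z / 2))^-1.
  rewrite -expRN -[RHS]ger0_norm ?expR_ge0 // -sqrtr_sqr; congr Num.sqrt.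
  rewrite expr2 -expRD -mulNr -mulrDl -mulr2n -(mulr_natr (- _)) mulfK ?pnatr_eq0 //.
  by rewrite /logv opprK lnK // posrE.
have s2 : 0 <= logv z / 2 by rewrite divr_ge0.
rewrite E mulrC ler_pdivrMr ?expR_gt0 //.
have H : (logv z / 2) ^+ j <= j`!%:R * expR (logv z / 2).
  case: j => [|j]; first by rewrite mul1r; apply: le_trans (expR_ge1Dx _); rewrite lerDl.
  have f0 : 0 < j.+1`!%:R :> R by rewrite ltr0n fact_gt0.
  rewrite -ler_pdivrMl // mulrC; apply: le_trans (expR_ge1Dxn j s2).
  by rewrite lerDr.
have -> : logv z ^+ j = 2 ^+ j * (logv z / 2) ^+ j.
  by rewrite -exprMn mulrCA mulfV ?mulr1 // pnatr_eq0.
by rewrite -mulrA ler_wpM2l // exprn_ge0.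
Qed.

Lemma Lic_asymp w : convergent w -> asymp (1 : R)^'- logv (Lic w) (zt w)%:P.
Proof.
move=> /(Li_zt R)[C HC]; apply: asymp_const; first exact: logv_pinfty.
move=> j; exists (`|C| * (2 ^+ j * j`!%:R)); apply: nearW => z.
have [z0 z1] := andP (clip01 z).
have s0 : 0 <= logv z by rewrite /logv oppr_ge0 ln_le0 // lerBlDr lerDl.
apply: (@le_trans _ _ (`|C| * (Num.sqrt (1 - clip z) * logv z ^+ j))).
  rewrite mulrA ler_wpM2r ?exprn_ge0 //; apply: le_trans (HC _ (clip01 z)) _.
  by rewrite ler_wpM2r ?sqrtr_ge0 // ler_norm.
by rewrite ler_wpM2l // sqrt_log_bound.
Qed.

Lemma Lic_conv v : valid v -> noy true v -> asymp (1 : R)^'- logv (Lic v) (zt v)%:P.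
Proof.
move=> vv v0; apply: Lic_asymp; rewrite /convergent vv /=.
by case: v {vv} v0 => // a v /=; case: a.
Qed.

Lemma Lic_hom z : is_hom (@sh_op bool) valid (Lic^~ z).
Proof. exact: Li_hom (clip01 z). Qed.

Lemma Lic_log z : Lic [:: true] z = logv z.
Proof. exact: Li_log (clip01 z). Qed.

Let opN : forall c d : bool, sh_op true c = Some d -> d != true.
Proof. by []. Qed.

Definition Zpol := regP (1 : R)^'- logv Lic.
Definition Zw := reg (1 : R)^'- logv Lic.

Let valid_tail w : valid (true :: w) -> valid w.
Proof. exact: valid_behead. Qed.

Lemma Zpol_asymp w : valid w -> asymp (1 : R)^'- logv (Lic w) (Zpol w).
Proof.
exact: (@regP_asymp R R (1 : R)^'- logv _ _ (@sh_op bool) true valid Lic zt opN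
  isT valid_sh valid_tail Lic_hom Lic_log Lic_conv).
Qed.

Lemma Zw_hom : is_hom (@sh_op bool) valid Zw.
Proof.
exact: (@reg_hom R R (1 : R)^'- logv _ logv_pinfty _ (@sh_op bool) true valid Lic zt opN
  isT isT valid_sh valid_tail Lic_hom Lic_log Lic_conv).
Qed.

Lemma Zw_true : Zw [:: true] = 0.
Proof.
exact: (@reg_letter R R (1 : R)^'- logv _ logv_pinfty _ (@sh_op bool) true valid Lic zt opN
  isT valid_sh valid_tail Lic_hom Lic_log Lic_conv).
Qed.

Lemma Zw_conv w : convergent w -> Zw w = zt w.
Proof.
move=> /andP[vw w0].
apply: (@reg_conv R R (1 : R)^'- logv _ logv_pinfty _ (@sh_op bool) true valid Lic zt opN
  isT valid_sh valid_tail Lic_hom Lic_log Lic_conv) => //.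
by case: w {vw} w0 => // -[].
Qed.

Lemma hsum_pinfty : hsum R n @[n --> \oo] --> +oo.
Proof.
apply/cvgryPge => M.
have [N MN] : exists N, M <= hsum R N.
  apply: contrapT => /forallNP H; apply: (@dvg_harmonic R).
  have E n : series harmonic n = hsum R n.
    elim: n => [|n IH]; first by rewrite /series /= big_geq // hsum0.
    by rewrite hsumS -IH /series /= big_nat_recr.
  apply: nondecreasing_is_cvgn; first by move=> m n mn; rewrite !E; apply: psum_homo.
  exists M => _ [n _ <-]; rewrite E ltW // ltNge.
  by apply/negP; apply: H.
exists N => // n /= Nn; apply: le_trans MN _; exact: psum_homo.
Qed.

Lemma HN_conv v : predT v -> noy 0%N v -> asymp \oo (hsum R) (HN R v) (zt (enc v))%:P.
Proof.
move=> _ vy; apply: asymp_const; first exact: hsum_pinfty.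
have [|C HC] := @zt_tail R (enc v); first by rewrite convergent_enc.
move=> j; have [K HK] := hsum_rs_bound R j; exists (C * K); apply: nearW => N.
have /andP[d0 dC] := HC N.
have C0 : 0 <= C.
  have r0 : 0 < rs R N.+1 by rewrite invr_gt0 sqrtr_gt0 ltr0n.
  by have := le_trans d0 dC; rewrite pmulr_lge0.
rewrite /HN distrC ger0_norm //.
apply: le_trans (_ : C * rs R N.+1 * hsum R N ^+ j <= _).
  by rewrite ler_wpM2r // exprn_ge0 // hsum_ge0.
by rewrite -mulrA ler_wpM2l // mulrC.
Qed.

Definition Zst := reg \oo (hsum R) (HN R).

Lemma HN_letter N : HN R [:: 0%N] N = hsum R N. Proof. by []. Qed.

Let predT_closed : qsh_closed st_op predT. Proof. by []. Qed.

Lemma Zst_hom : is_hom st_op predT Zst.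
Proof.
exact: (@reg_hom R nat \oo (hsum R) _ hsum_pinfty _ st_op 0%N predT (HN R) (zt \o enc) st_op0
  isT isT predT_closed (fun _ _ => isT) (HN_hom R) HN_letter HN_conv).
Qed.

Lemma Zst_letter : Zst [:: 0%N] = 0.
Proof.
exact: (@reg_letter R nat \oo (hsum R) _ hsum_pinfty _ st_op 0%N predT (HN R) (zt \o enc) st_op0
  isT predT_closed (fun _ _ => isT) (HN_hom R) HN_letter HN_conv).
Qed.

Lemma Zst_conv v : noy 0%N v -> Zst v = zt (enc v).
Proof.
exact: (@reg_conv R nat \oo (hsum R) _ hsum_pinfty _ st_op 0%N predT (HN R) (zt \o enc) st_op0
  isT predT_closed (fun _ _ => isT) (HN_hom R) HN_letter HN_conv).
Qed.

Definition Zs (r : seq nat) : R := Zw (enc r).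

Lemma Zs_conv v : noy 0%N v -> Zs v = zt (enc v).
Proof. by move=> vy; apply: Zw_conv; rewrite convergent_enc. Qed.

Lemma stuffle_tail v r : noy 0%N v ->
  (HN R v N - zt (enc v)) * HN R r N @[N --> \oo] --> (0 : R).
Proof.
move=> vy; have vc := HN_conv isT vy.
have [P HP] : exists P, asymp \oo (hsum R) (HN R r) P.
  exact: (@asymp_exists R nat \oo (hsum R) _ _ st_op 0%N predT (HN R) (zt \o enc) st_op0
    isT predT_closed (fun _ _ => isT) (HN_hom R) HN_letter HN_conv).
have -> : (fun N => (HN R v N - zt (enc v)) * HN R r N) =
  (fun N => (HN R v N - (zt (enc v))%:P.[hsum R N]) * P.[hsum R N] +
    (HN R v N - (zt (enc v))%:P.[hsum R N]) * (HN R r N - P.[hsum R N])).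
  by apply/funext => N; rewrite hornerC; ring.
rewrite -[0](addr0 0); apply: cvgD; first exact: vc.
rewrite -[0](mulr0 0); apply: cvgM; exact: asymp_cvg.
Qed.

(** By [Li_psum] and the stuffle product of truncated sums, the defect of the relation for
    polylogarithms is -(1-z) times the series with coefficients [s N]. These tend to 0 by
    [stuffle_tail], so the defect does too ([abel_null]), and its regularization polynomial [Q] is
    0. *)
Lemma Zs_stuffle v r : noy 0%N v -> Qs st_op Zs v r = Zs v * Zs r.
Proof.
move=> vy; rewrite Zs_conv //.
pose Q := \sum_(w <- qsh st_op v r) Zpol (enc w) - (zt (enc v)) *: Zpol (enc r).
suff : Q = 0.
  move=> /(congr1 (fun P => P.[0])); rewrite hornerD hornerN hornerZ horner_sum horner0.
  by move/eqP; rewrite subr_eq0 => /eqP.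
apply: (poly_cvg0 logv_pinfty).
have As : asymp (1 : R)^'- logv (fun z => \sum_(w <- qsh st_op v r) Lic (enc w) z
     + (-1) * (zt (enc v) * Lic (enc r) z)) Q.
  have -> : Q = \sum_(w <- qsh st_op v r) Zpol (enc w) + (-1) *: (zt (enc v) *: Zpol (enc r)).
    by rewrite scaleN1r.
  apply: asympD; first by apply: asymp_sum => w; apply: Zpol_asymp; apply: valid_enc.
  by do 2!apply: asympZ; apply: Zpol_asymp; apply: valid_enc.
pose D z := \sum_(w <- qsh st_op v r) Lic (enc w) z + (-1) * (zt (enc v) * Lic (enc r) z).
suff D0 : D z @[z --> (1 : R)^'-] --> (0 : R).
  rewrite -[0](subrr 0); apply: cvg_trans (cvgB D0 (asymp_cvg As)).
  apply: near_eq_cvg; apply: nearW => z.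
  by rewrite -[LHS]/(D z - (D z - Q.[logv z])); ring.
(* The sign makes [s] nonnegative, as [abel_null] and [summ] require. *)
pose s N := (zt (enc v) - HN R v N) * HN R r N.
have [|C HC] := @zt_tail R (enc v); first by rewrite convergent_enc.
have s0 N : 0 <= s N.
  by apply: mulr_ge0; [case/andP: (HC N)|apply: psum_ge0].
have sc : s N @[N --> \oo] --> (0 : R).
  have -> : s = fun N => - ((HN R v N - zt (enc v)) * HN R r N).
    by apply/funext => N; rewrite /s; ring.
  by rewrite -oppr0; apply: cvgN; apply: stuffle_tail.
have lim0 : - ((1 - z) * nnsum (fun N => z ^+ N * s N)) @[z --> (1 : R)^'-] --> (0 : R).
  by rewrite -[0]oppr0; apply: cvgN; apply: abel_null.
apply: cvg_trans lim0; apply: near_eq_cvg.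
near=> z; have z01 : 0 < z < 1 by near: z; exact: near_clip.
have z01' : 0 <= z < 1 by case/andP: z01 => z0 z1; rewrite ltW.
rewrite /D /Lic clip_id //.
have [sr rE] := Li_psum (enc r) z01'.
rewrite (eq_bigr (fun w => (1 - z) * nnsum (fun N => z ^+ N * psum R (enc w) N))); last first.
  by move=> w _; case: (Li_psum (enc w) z01').
rewrite -mulr_sumr rE.
have [|sw wE] := @summ_sum R _ (qsh st_op v r) (fun w N => z ^+ N * psum R (enc w) N).
  by move=> w _; case: (Li_psum (enc w) z01').
rewrite -wE.
have E1 : (fun N => \sum_(w <- qsh st_op v r) z ^+ N * psum R (enc w) N) =
          fun N => z ^+ N * (HN R v N * HN R r N).
  by apply/funext => N; rewrite -mulr_sumr (HN_hom R N).2.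
rewrite E1; rewrite E1 in sw.
have ss : summ (fun N => z ^+ N * s N).
  have zt0 : 0 <= zt (enc v) by apply: nnsum_ge0; apply: summ_cf; rewrite convergent_enc.
  apply: (proj1 (le_summ _ (proj1 (summZ zt0 sr)))) => N; apply/andP; split.
    by rewrite mulr_ge0 // exprn_ge0 //; case/andP: z01'.
  rewrite [leRHS]mulrCA ler_wpM2l ?exprn_ge0 //; first by case/andP: z01'.
  by rewrite ler_wpM2r ?psum_ge0 // lerBlDr lerDl psum_ge0.
have [_ E2] := summD sw ss.
have zt0 : 0 <= zt (enc v) by apply: nnsum_ge0; apply: summ_cf; rewrite convergent_enc.
have [_ E3] := summZ zt0 sr.
have E4 : nnsum (fun N => z ^+ N * (HN R v N * HN R r N) + z ^+ N * s N) =
   nnsum (fun N => zt (enc v) * (z ^+ N * psum R (enc r) N)).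
  by apply: eq_nnsum => N; rewrite /s /HN; ring.
rewrite E4 E3 in E2.
have -> : zt (enc v) * ((1 - z) * nnsum (fun N => z ^+ N * psum R (enc r) N)) =
  (1 - z) * (zt (enc v) * nnsum (fun N => z ^+ N * psum R (enc r) N)) by ring.
by rewrite E2; ring.
Unshelve. all: by end_near. Qed.

End RegularizedValues.

(* Duality by the connected sums of Seki and Yamamoto. *)
Section Duality.
Variable R : realType.
Local Notation cf := (@cf R).

Definition connector (m n : nat) : R := m`!%:R * n`!%:R / (m + n)`!%:R.

Let factR_neq0 n : n`!%:R != 0 :> R.
Proof. by rewrite pnatr_eq0 -lt0n fact_gt0. Qed.

Lemma connector_ge0 m n : 0 <= connector m n.
Proof. by rewrite /connector !mulr_ge0 ?invr_ge0. Qed.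

Lemma connectorC m n : connector m n = connector n m.
Proof. by rewrite /connector addnC [_ * n`!%:R]mulrC. Qed.

Lemma connector0 n : connector 0 n = 1.
Proof. by rewrite /connector fact0 mul1r mulfV. Qed.

(** The difference form of 1/m C(m,n) = sum over b > n of 1/b C(m,b), which moves a factor from one
    word to the other. *)
Lemma connector_step m n :
  n.+1%:R^-1 * connector m.+1 n.+1 = m.+1%:R^-1 * (connector m.+1 n - connector m.+1 n.+1).
Proof.
rewrite /connector addSn addnS !factS !natrM -!natr1 natrD.
have := factR_neq0 m; have := factR_neq0 n; have := factR_neq0 (m + n).
have m0 : m%:R + 1 != 0 :> R by rewrite natr1 pnatr_eq0.
have n0 : n%:R + 1 != 0 :> R by rewrite natr1 pnatr_eq0.
have mn0 : m%:R + n%:R + 1 != 0 :> R by rewrite -natrD natr1 pnatr_eq0.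
have mn1 : m%:R + n%:R + 1 + 1 != 0 :> R by rewrite -natrD !natr1 pnatr_eq0.
by move=> a b c; field; rewrite ?mn0 ?mn1 ?m0 ?n0 ?a ?b ?c.
Qed.

Lemma connector_le m n : connector m.+1 n <= n.+1%:R^-1.
Proof.
elim: m => [|m IH].
  by rewrite /connector mul1r add1n factS natrM invfM mulrCA mulfV // mulr1.
apply: le_trans IH.
have -> : connector m.+2 n = m.+2%:R / (m.+2 + n)%:R * connector m.+1 n.
  by rewrite /connector factS addSn (factS (m.+1 + n)) !natrM invfM; ring.
rewrite ler_piMl ?connector_ge0 // ler_pdivrMr ?ltr0n // mul1r ler_nat.
by rewrite leq_addr.
Qed.

Lemma connector_sum m n :
  summ (fun k => (n + k).+1%:R^-1 * connector m.+1 (n + k).+1) /\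
  nnsum (fun k => (n + k).+1%:R^-1 * connector m.+1 (n + k).+1)
    = m.+1%:R^-1 * connector m.+1 n.
Proof.
have P N : \sum_(k < N) (n + k).+1%:R^-1 * connector m.+1 (n + k).+1 =
    m.+1%:R^-1 * (connector m.+1 n - connector m.+1 (n + N)).
  elim: N => [|N IH]; first by rewrite big_ord0 addn0 subrr mulr0.
  by rewrite big_ord_recr /= IH connector_step addnS; ring.
have [|N|s _] := @summ_bounded R (fun k => (n + k).+1%:R^-1 * connector m.+1 (n + k).+1)
    (m.+1%:R^-1 * connector m.+1 n).
- by move=> k; rewrite mulr_ge0 ?invr_ge0 ?connector_ge0.
- by rewrite P ler_wpM2l ?invr_ge0 // gerBl connector_ge0.
split=> //; have := summ_cvg s; under eq_fun do rewrite P.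
move=> H1; have H2 : m.+1%:R^-1 * (connector m.+1 n - connector m.+1 (n + N))
    @[N --> \oo] --> m.+1%:R^-1 * (connector m.+1 n - 0).
  apply: cvgMr; apply: cvgB; first exact: cvg_cst.
  apply: (@squeeze_cvgr _ _ _ _ (fun=> 0) harmonic); last first.
  - exact: cvg_harmonic.
  - exact: cvg_cst.
  apply: nearW => N; rewrite connector_ge0 /=; apply: le_trans (connector_le _ _) _.
  by rewrite /harmonic /= lef_pV2 ?posrE ?ltr0n // ler_nat ltnS leq_addl.
by rewrite (cvg_unique (@norm_hausdorff _ _) H1 H2) subr0.
Qed.

Local Open Scope ereal_scope.

Definition connected (u v : seq bool) : \bar R :=
  \sum_(m <oo) \sum_(n <oo) (cf u m * cf v n * connector m n)%:E.

Let term_ge0 u v m n : 0 <= (cf u m * cf v n * connector m n)%:E.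
Proof. by rewrite lee_fin !mulr_ge0 ?cf_ge0 ?connector_ge0. Qed.

Lemma connectedC u v : connected u v = connected v u.
Proof.
rewrite /connected nneseries_interchange; last by move=> *; apply: term_ge0.
apply: eq_eseriesr => n _; apply: eq_eseriesr => m _.
by rewrite connectorC [(cf u m * _)%R]mulrC.
Qed.

Lemma connected_nil v : connected [::] v = \sum_(n <oo) (cf v n)%:E.
Proof.
rewrite /connected (nneseries_recl (P := xpredT)) //; last first.
  by move=> m _; apply: nneseries_ge0 => n _ _; apply: term_ge0.
rewrite [X in _ + X]eseries0 ?adde0; last first.
  by case=> // m _ _; rewrite eseries0 // => n _ _; rewrite /= !mul0r.
by apply: eq_eseriesr => n _; rewrite /= connector0 mul1r mulr1.
Qed.

(** The factor 1/m of the outer [false] on the left is traded by [connector_sum] for a new variable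
    b > n with factor 1/b, an outer [true] on the right. The remaining left word is nonempty, so m =
    0 contributes nothing. *)
Lemma connected_transport a u v : connected (false :: a :: u) v = connected (a :: u) (true :: v).
Proof.
apply: eq_eseriesr => -[|m] _.
  by rewrite !eseries0 // => n _ _; rewrite !cf_cons0 !mul0r.
set c := cf (a :: u) m.+1.
have pos n b k : 0 <= (c * cf v n * (b%:R^-1 * connector m.+1 k))%:E.
  rewrite lee_fin; apply: mulr_ge0; first by apply: mulr_ge0; apply: cf_ge0.
  by apply: mulr_ge0; rewrite ?invr_ge0 ?connector_ge0.
transitivity (\sum_(n <oo) \sum_(b <oo)
   (if (n < b)%N then (c * cf v n * (b%:R^-1 * connector m.+1 b))%:E else 0)).
  apply: eq_eseriesr => n _.
  rewrite -[RHS](_ : \sum_(k <oo) (c * cf v n *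
     ((n + k).+1%:R^-1 * connector m.+1 (n + k).+1))%:E = _); last first.
    rewrite -[LHS](nneseries_shift n.+1); last first.
      by move=> k; apply: pos.
    apply: eq_eseriesr => b _; case: ltnP => // lt.
    by rewrite -addSn subnKC.
  have [s sE] := connector_sum m n.
  under eq_eseriesr do rewrite EFinM.
  rewrite nneseriesZl; last by move=> k _; rewrite lee_fin; apply: s.1.
  rewrite nnsumE // sE -EFinM; congr (_%:E).
  by rewrite (_ : cf [:: false, a & u] m.+1 = (m.+1%:R^-1 * c)%R) //; ring.
rewrite nneseries_interchange; last first.
  by move=> n b; case: ifP.
apply: eq_eseriesr => b _; rewrite nneseries_ltn; last first.
  by move=> n; apply: pos.
rewrite sumEFin; congr (_%:E).
rewrite [cf (true :: v) b]/= !mulr_sumr mulr_suml.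
by apply: eq_bigr => n _; ring.
Qed.

(** Letters pass one at a time, negated and in reverse order: [false] by transport, [true] by
    transport read backwards with the sides exchanged. The latter needs a nonempty [v]. *)
Lemma connected_dual u v : valid u -> u != [::] -> v != [::] ->
  connected u v = connected [::] (rev (map negb u) ++ v).
Proof.
elim: u v => // a u IH v vu _ v0.
have v'0 b (s : seq bool) : b :: s != [::] by [].
have step : connected (a :: u) v = connected u (~~ a :: v).
  case: a vu => vu; last first.
    by case: u vu {IH} => // b u _; apply: connected_transport.
  by rewrite connectedC; case: v v0 => // b v _; rewrite -connected_transport connectedC.
rewrite step; have [u0|u0] := eqVneq u [::]; first by rewrite u0.
rewrite IH ?(valid_behead vu) //=.
by rewrite rev_cons cat_rcons.
Qed.

Lemma duality w : convergent w ->
  \sum_(n <oo) (cf w n)%:E = \sum_(n <oo) (cf (rev (map negb w)) n)%:E.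
Proof.
rewrite -!connected_nil; case: w => // -[] u /andP[vu // _].
have u0 : u != [::] by case: u vu.
(* The leading [false] of a convergent word is moved first, which makes the right word nonempty as
   [connected_dual] demands. *)
rewrite connectedC; case: u u0 vu => // b u _ vu.
rewrite connected_transport connected_dual ?(valid_behead vu) //=.
by rewrite !rev_cons -!cats1 -!catA.
Qed.

End Duality.

(** * Nested sums *)

Section NestedSums.
Variable R : realType.
Local Notation cf := (@cf R).

Lemma mzv_term_rcons k a m n : size m = size k ->
  mzv_term R (rcons k a) (rcons m n) = mzv_term R k m * (n%:R ^+ a)^-1.
Proof.
move=> mk; rewrite /mzv_term /depth size_rcons big_ord_recr /=; congr (_ * _).
  by apply: eq_bigr => i _; rewrite !nth_rcons mk ltn_ord.
by rewrite !nth_rcons mk ltnn eqxx.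
Qed.

Lemma mzv_term_ge0 k m : 0 <= mzv_term R k m.
Proof. by apply: prodr_ge0 => i _; rewrite invr_ge0 exprn_ge0. Qed.

Lemma summation_range0 : summation_range 0 = [set [::]].
Proof. by apply/seteqP; split => -[|a m] //= []. Qed.

Lemma summation_rangeS n :
  set_bij (summation_range n `*`` (fun m => [set N | (last 0 m < N)%N]))
    (summation_range n.+1) (fun p => rcons p.1 p.2).
Proof.
split.
- move=> [m N] [[/= sm pm] lt]; split; first by rewrite size_rcons sm.
  by rewrite rcons_path pm.
- by move=> [m N] [m' N'] _ _ /= /rcons_inj [-> ->].
- case/lastP => [[]//|m N] [/= sm]; rewrite rcons_path => /andP[pm lt].
  exists (m, N) => //=; split=> //; split=> //.
  by move: sm; rewrite size_rcons => -[].
Qed.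

Local Open Scope ereal_scope.

(** The weight [g] on the largest variable serves the induction: summing that variable out leaves
    the weight [G] on the next one. It is extended-valued because [G] may be infinite. *)
Lemma esum_nested k (g : nat -> \bar R) : is_index k -> (forall n, 0 <= g n) ->
  \esum_(m in summation_range (size k)) (g (last 0%N m) * (mzv_term R k m)%:E) =
  \sum_(n <oo) g n * (cf (enc (rev (map predn k))) n)%:E.
Proof.
elim/last_ind: k g => [|k a IH] g ik g0.
  rewrite summation_range0 esum_set1; last by rewrite mule_ge0 // lee_fin mzv_term_ge0.
  rewrite (nneseries_recl (P := xpredT)) //; last first.
    by move=> n _; rewrite mule_ge0 // lee_fin cf_ge0.
  rewrite [X in _ + X]eseries0 ?adde0; last by case=> // n _ _; rewrite /= mule0.
  by rewrite /mzv_term /depth big_ord0.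
move: ik; rewrite /is_index all_rcons => /andP[a0 ik].
rewrite size_rcons (reindex_esum _ _ _ _ (summation_rangeS (size k))) /=.
pose h N := g N * (N%:R ^- a)%:E.
have h0 N : 0 <= h N by rewrite mule_ge0 // lee_fin invr_ge0 exprn_ge0.
pose G M := \sum_(N <oo) (if (M < N)%N then h N else 0).
have G0 M : 0 <= G M by apply: nneseries_ge0 => N _ _; case: ifP.
pose b m N := g N * (mzv_term R (rcons k a) (rcons m N))%:E.
transitivity (\esum_(m in summation_range (size k))
   \esum_(N in [set N | (last 0 m < N)%N]) b m N).
  rewrite esum_esum; last by move=> *; rewrite mule_ge0 // lee_fin mzv_term_ge0.
  by apply: eq_esum => -[m N] _ /=; rewrite last_rcons.
transitivity (\esum_(m in summation_range (size k)) (G (last 0%N m) * (mzv_term R k m)%:E)).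
  apply: eq_esum => m [sm _].
  rewrite -nneseries_esum; last by move=> *; rewrite mule_ge0 // lee_fin mzv_term_ge0.
  rewrite /G muleC -nneseriesZr ?lee_fin ?mzv_term_ge0 //; last by move=> N; case: ifP.
  rewrite eseries_mkcond; apply: eq_eseriesr => N _; case: ifP => _; last by rewrite mule0.
  by rewrite /b mzv_term_rcons // /h EFinM muleCA.
rewrite IH // -[LHS](eq_eseriesr (f := fun M => \sum_(N <oo)
   (if (M < N)%N then (cf (enc (rev (map predn k))) M)%:E * h N else 0))); last first.
  move=> M _; rewrite /G muleC -nneseriesZr ?lee_fin ?cf_ge0 //; last by move=> N; case: ifP.
  by apply: eq_eseriesr => N _; case: ifP => _ //; rewrite mule0.
rewrite nneseries_interchange; last first.
  by move=> M N; case: ifP => // _; rewrite mule_ge0 // lee_fin cf_ge0.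
apply: eq_eseriesr => N _; rewrite nneseries_ltn; last first.
  by move=> M; rewrite mule_ge0 // lee_fin cf_ge0.
rewrite -ge0_sume_distrl; last by move=> M _; rewrite lee_fin cf_ge0.
rewrite sumEFin map_rcons rev_rcons cf_enc_cons prednK // /h.
by rewrite muleC -muleA EFinM.
Qed.

Lemma zeta_zt k : is_index k -> zeta R k = zt R (enc (rev (map predn k))).
Proof.
move=> ik; rewrite /zeta /zt /nnsum; congr fine.
have := esum_nested (g := fun=> 1) ik (fun=> lee01).
under eq_esum do rewrite mul1e; move=> ->.
by apply: eq_eseriesr => n _; rewrite mul1e.
Qed.

Local Open Scope ring_scope.

Lemma polylog_Li k (z : R) : 0 <= z -> is_index k ->
  polylog k z = Li (enc (rev (map predn k))) z.
Proof.
move=> z0 ik; rewrite /polylog -[RHS]/(fine _); congr fine.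
have zn0 n : (0 <= (z ^+ n)%:E)%E by rewrite lee_fin exprn_ge0.
transitivity (\sum_(n <oo) ((z ^+ n)%:E * (cf (enc (rev (map predn k))) n)%:E))%E.
  by rewrite -(esum_nested ik zn0); apply: eq_esum => m _; rewrite EFinM.
by apply: eq_eseriesr => n _; rewrite EFinM.
Qed.

Lemma regularization_Zpol k : is_index k ->
  regularization_sh R k = Zpol R (enc (rev (map predn k))).
Proof.
move=> ik; set w := enc _; have vw : valid w by apply: valid_enc.
have E P : is_regularization_sh k P ->
    Lic w z - P.[logv z] @[z --> (1 : R)^'-] --> (0 : R).
  apply: cvg_trans; apply: near_eq_cvg; near=> z.
  have z01 : 0 < z < 1 by near: z; exact: near_clip.
  by rewrite /Lic /logv clip_id // polylog_Li //; case/andP: z01 => /ltW.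
have RZ : Lic w z - (Zpol R w).[logv z] @[z --> (1 : R)^'-] --> (0 : R).
  exact: asymp_cvg (Zpol_asymp vw).
apply: xget_subset1 => [|P Q /E RP /E RQ].
  apply: cvg_trans RZ; apply: near_eq_cvg; near=> z.
  have z01 : 0 < z < 1 by near: z; exact: near_clip.
  by rewrite /Lic /logv clip_id // polylog_Li //; case/andP: z01 => /ltW.
apply/eqP; rewrite -subr_eq0; apply/eqP.
apply: (poly_cvg0 (@logv_pinfty R)).
have -> : (fun z => (P - Q).[logv z]) =
    (fun z => (Lic w z - Q.[logv z]) - (Lic w z - P.[logv z])).
  by apply/funext => z; rewrite hornerD hornerN; ring.
by rewrite -[0](subrr 0); apply: cvgB.
Unshelve. all: by end_near. Qed.

Lemma zeta_reg_Zs k : is_index k -> zeta_reg_sh R k = Zs R (rev (map predn k)).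
Proof. by move=> ik; rewrite /zeta_reg_sh regularization_Zpol. Qed.

End NestedSums.

(** With [f] zero at y, (m+1) f(y^(m+1) v) is minus a sum over words of the same degree with fewer
    leading y, so regularization stays in the span of convergent values of that degree. *)
Lemma lead_graded (A : eqType) (op : A -> A -> option A) (y : A) (R : realType)
    (V : pred (seq A)) (f : seq A -> R) (d : seq A -> nat) (X : nat -> set R) :
  (forall b c, op y b = Some c -> c != y) ->
  V [:: y] -> qsh_closed op V -> (forall w, V (y :: w) -> V w) ->
  (forall i, qsubspace (X i)) -> is_hom op V f -> f [:: y] = 0 ->
  (forall u v w, w \in qsh op u v -> d w = (d u + d v)%N) ->
  (forall w, d (y :: w) = (d [:: y] + d w)%N) ->
  (forall v, V v -> noy y v -> X (d v) (f v)) ->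
  forall w, V w -> X (d w) (f w).
Proof.
move=> opy Vy Vq Vt XQ [_ fM] fy dq dy f0.
apply: (@lead_rect_prop _ _ _ opy) => // m v vy Vm _ IH.
apply: (qsub_natdiv (XQ _) (ltn0Sn m)).
have -> : m.+1%:R * f (nseq m.+1 y ++ v) = - \sum_(w <- ins_rest op y m v) f w.
  by apply/eqP; rewrite -addr_eq0 -Qs_ins -fM // fy mul0r.
apply: (qsubN (XQ _)); apply: (qsub_sum (XQ _)) => w wm _.
have [Vw Xw] := IH w wm.
by rewrite [d _]dy -(dq _ _ _ (ins_rest_sub wm)).
Qed.

Lemma Sh_map (A B : eqType) (R : comNzRingType) (h : A -> B) (f : seq B -> R) u v :
  Qs (@sh_op B) f (map h u) (map h v) = Qs (@sh_op A) (f \o map h) u v.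
Proof.
move: u v f; apply: size_ind2 => [v f|u f|a u b v IH1 IH2 _ f].
- by rewrite !Qs0s.
- by rewrite !Qss0.
by rewrite !map_cons !Qs_cons /= -!map_cons IH1 IH2.
Qed.

Lemma valid_rev w : valid (rev w) = noy false w.
Proof. by case: w => // -[] w; rewrite /valid rev_cons last_rcons. Qed.

Lemma noy_rev w : noy false (rev w) = valid w.
Proof. by rewrite -valid_rev revK. Qed.

Lemma enc_cat r s : enc (r ++ s) = enc r ++ enc s.
Proof. by elim: r => //= a r ->; rewrite -catA. Qed.

(** Reversing an index is not reversing its word, since each y closes its block; shifting one y
    repairs this. It translates finite values into the rotation of y. *)
Lemma rcons_rev_enc r : rcons (rev (enc r)) true = true :: enc (rev r).
Proof.
elim: r => // a r IH; rewrite [enc (a :: r)]/= rev_cat rev_cons rev_nseq IH.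
by rewrite (rev_cons a) -[rcons (rev r) a]cats1 enc_cat /= rcons_cat cats1.
Qed.

Lemma wt_predn k : is_index k -> wt (map predn k) = weight k.
Proof.
rewrite /is_index /weight; elim: k => //= a k IH /andP[a0 /IH E].
by rewrite wt_cons E prednK.
Qed.

Lemma predn_succn l : map predn (map succn l) = l.
Proof. by rewrite -map_comp map_id. Qed.

Lemma is_index_succn l : is_index (map succn l).
Proof. by apply/allP => _ /mapP[a _ ->]. Qed.

(** * Comparison of the two spaces *)

Section Main.
Variable R : realType.
Local Notation Z := (Z_space R).
Local Notation Zs := (Zs R).
Local Notation Zw := (Zw R).
Local Notation zt := (zt R).

Lemma Z_sub i : qsubspace (Z i).
Proof. exact: Qspan_sub. Qed.

Lemma Z_zt r : noy 0%N r -> Z (wt r) (zt (enc r)).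
Proof.
move=> r0; apply: Qspan_gen; exists (map succn (rev r)); last first.
  by rewrite zeta_zt ?is_index_succn // predn_succn revK.
split; last by rewrite -wt_predn ?is_index_succn // predn_succn wt_rev.
rewrite /admissible is_index_succn /=; case: r r0 => [|a r] //= a0.
by rewrite rev_cons map_rcons last_rcons !ltnS lt0n a0 orbT.
Qed.

Lemma Z_ind i (X : set R) : qsubspace X ->
  (forall r, noy 0%N r -> wt r = i -> X (zt (enc r))) -> forall d, Z i d -> X d.
Proof.
move=> XQ H; apply: (Qspan_min XQ) => _ [k [/andP[ik ak] wk] <-].
rewrite zeta_zt //; apply: H; last by rewrite wt_rev wt_predn.
move: ak; case/lastP: {ik wk} k => // k a.
rewrite map_rcons rev_rcons last_rcons -size_eq0 size_rcons /=.
by case: a => [|[]].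
Qed.

Lemma Zw_Z w : valid w -> Z (size w) (Zw w).
Proof.
move: w; apply: (@lead_graded _ (@sh_op bool) true) => //.
- exact: valid_sh.
- exact: Z_sub.
- exact: Zw_hom.
- exact: Zw_true.
- exact: size_sh.
move=> v vv v0; have [r E] := enc_onto vv.
have cv : convergent v by rewrite /convergent vv; case: v {vv E} v0 => // -[].
by rewrite Zw_conv // E size_enc; apply: Z_zt; rewrite -convergent_enc -E.
Qed.

Lemma Zs_in_Z r : Z (wt r) (Zs r).
Proof. by rewrite -size_enc; apply/Zw_Z/valid_enc. Qed.

Lemma Zst_in_Z r : Z (wt r) (Zst R r).
Proof.
move: r (erefl : predT r); apply: (@lead_graded _ st_op 0%N) => //.
- exact: st_op0.
- exact: Z_sub.
- exact: Zst_hom.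
- exact: Zst_letter.
- exact: wt_qsh.
- by move=> w; rewrite wt_cons.
by move=> v _ v0; rewrite Zst_conv //; apply: Z_zt.
Qed.

Lemma Z_mul i j a b : Z i a -> Z j b -> Z (i + j)%N (a * b).
Proof.
move=> Za Zb; move: a Za; apply: (Z_ind (qsub_mulr _ (Z_sub _))) => r r0 ri.
move: b Zb; apply: (Z_ind (qsub_mull _ (Z_sub _))) => s s0 sj.
rewrite -!Zs_conv // -Zs_stuffle //; apply: (qsub_sum (Z_sub _)) => w /wt_qsh E _.
by rewrite -ri -sj -E; apply: Zs_in_Z.
Qed.

Lemma Zs_nil : Zs [::] = 1.
Proof. exact: (Zw_hom R).1. Qed.

Lemma Zs_ones m : Zs (nseq m.+1 0%N) = 0.
Proof.
have E n : enc (nseq n 0%N) = nseq n true by elim: n => //= n ->.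
rewrite /Zs E; have m0 : m.+1%:R != 0 :> R by rewrite pnatr_eq0.
apply: (mulfI m0); rewrite mulr0 -Sh_nseq -(Zw_hom R).2 ?Zw_true ?mul0r //.
by rewrite -E; apply: valid_enc.
Qed.

Lemma Z0_1 : Z 0 1.
Proof. by rewrite -Zs_nil; apply: (Zs_in_Z [::]). Qed.

(** [Zs] reads the largest variable first, so the reversal in the second factor of the definition
    appears on the first factor of [ZF]. *)
Lemma zeta_F_ZF k : is_index k -> zeta_F_sh R k = ZF Zs (map predn k).
Proof.
move=> ik; rewrite /ZF /conv size_map; apply: eq_bigr => i _.
have /andP[i1 i2] : is_index (take i k) && is_index (drop i k).
  by rewrite /is_index -all_cat cat_take_drop.
rewrite !zeta_reg_Zs //=; last by rewrite /is_index all_rev.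
by rewrite /twist map_rev revK map_take -!map_drop wt_predn // mulrCA mulrA.
Qed.

Lemma Z_F_ZFspan k : Z_F_sh_space R k = ZFspan Zs k.
Proof.
congr Qspan; apply/seteqP; split=> [_ [l [il wl] <-]|_ [l /= wl <-]].
  by exists (map predn l); rewrite /= ?wt_predn ?zeta_F_ZF.
exists (map succn l); last by rewrite zeta_F_ZF ?is_index_succn // predn_succn.
by split; [exact: is_index_succn|rewrite -wt_predn ?is_index_succn ?predn_succn].
Qed.
(* The hom on all words with value 0 at the letter [false] that extends [Zw]. *)
Definition word_value (w : seq bool) : R := extend false (fun s => Zw (rev s)) (rev w).

Let Zw_rev_hom : is_hom (@sh_op bool) (noy false) (fun s => Zw (rev s)).
Proof.
have [Z1 ZM] := Zw_hom R; split=> [//|u v u0 v0].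
by rewrite ZM ?valid_rev // Qs_rev.
Qed.

Lemma word_value_hom : is_hom (@sh_op bool) predT word_value.
Proof.
have [e1 eM] := extend_hom Zw_rev_hom; split=> [//|u v _ _].
by rewrite /word_value eM // Qs_rev.
Qed.

Lemma word_value_valid w : valid w -> word_value w = Zw w.
Proof. by move=> vw; rewrite /word_value extend_noy ?revK // noy_rev. Qed.

Lemma word_value_true : word_value [:: true] = 0.
Proof. by rewrite word_value_valid // Zw_true. Qed.

Lemma word_value_false : word_value [:: false] = 0.
Proof. exact: (extend_nseq _ _ 1). Qed.

Lemma word_value_Z w : Z (size w) (word_value w).
Proof.
rewrite -size_rev /word_value; move: (rev w) (erefl : predT (rev w)) => {}w.
apply: (@lead_graded _ (@sh_op bool) false) => //.
- exact: Z_sub.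
- exact: extend_hom.
- exact: size_sh.
move=> v _ v0; rewrite extend_noy // -size_rev; apply: Zw_Z.
by rewrite valid_rev.
Qed.

Definition dual (w : seq bool) := rev (map negb w).

Lemma word_value_dual_hom : is_hom (@sh_op bool) predT (word_value \o dual).
Proof.
have [g1 gM] := word_value_hom; split=> [//|u v _ _].
by rewrite /= /dual gM // Qs_rev Sh_map.
Qed.

Lemma word_value_dual_convergent w : convergent w -> word_value (dual w) = word_value w.
Proof.
case: w => // a w cw.
have cd : convergent (dual (a :: w)).
  case/andP: cw => vw; case: a vw => // vw _; rewrite /convergent /dual /= rev_cons.
  rewrite {1}/valid last_rcons /=; case/lastP: w vw => // w b.
  by rewrite /valid /= last_rcons map_rcons rev_rcons => ->.
rewrite !word_value_valid; try by [case/andP: cw|case/andP: cd].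
by rewrite !Zw_conv //; apply: (congr1 fine (esym (duality R cw))).
Qed.

Lemma word_value_dual w : word_value (dual w) = word_value w.
Proof.
(* Duality of convergent words spreads by uniqueness of homomorphisms: here to words with leading
   [true], both sides being 0 at that letter. *)
have dv v : valid v -> word_value (dual v) = word_value v.
  apply: (@hom_unique _ (@sh_op bool) true _ _ valid (word_value \o dual) word_value) => //.
  - exact: valid_sh.
  - by have [g1 gM] := word_value_dual_hom; split=> // *; apply: gM.
  - by have [g1 gM] := word_value_hom; split=> // *; apply: gM.
  - by rewrite word_value_true; apply: word_value_false.
  move=> {}v vv v0; apply: word_value_dual_convergent; rewrite /convergent vv.
  by case: v {vv} v0 => // -[].
(* The same argument on reversed words removes the trailing [false]. *)
rewrite -[w]revK; move: (rev w) (erefl : predT (rev w)) => {}w.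
apply: (@hom_unique _ (@sh_op bool) false _ _ predT (word_value \o dual \o rev) (word_value \o rev)) => //.
- by have [g1 gM] := word_value_dual_hom; split=> // *; rewrite /= -Qs_rev -gM.
- by have [g1 gM] := word_value_hom; split=> // *; rewrite /= -Qs_rev -gM.
- by rewrite /= word_value_false; apply: word_value_true.
by move=> v _ v0; apply: dv; rewrite valid_rev.
Qed.

Lemma wt_gt0 l : (0 < wt l)%N = (l != [::]).
Proof. by case: l => // a l; rewrite wt_cons. Qed.

Lemma ZF_ends (X : set R) l : qsubspace X -> l != [::] ->
  (forall i j p q, (0 < i)%N -> (0 < j)%N -> (i + j)%N = wt l -> Z i p -> Z j q -> X (p * q)) ->
  X (ZF Zs l) -> X (Zs (rev l) + (-1) ^+ wt l * Zs l).
Proof.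
move=> XQ; case E: l => [//|a l'] _ XM XF.
apply: (qsub_congr XQ) XF; move: XM; rewrite -E => XM.
have sl : size l = (size l').+1 by rewrite E.
pose s := \sum_(i < size l') Zs (rev (take i.+1 l)) * twist Zs (drop i.+1 l).
have ZE : ZF Zs l = twist Zs l + (s + Zs (rev l)).
  rewrite /ZF /conv sl big_ord_recl big_ord_recr /= take0 drop0 /bump /= add1n -sl.
  by rewrite take_size drop_size Zs_nil mul1r /twist !mul1r Zs_nil mulr1.
have -> : Zs (rev l) + (-1) ^+ wt l * Zs l - ZF Zs l = - s by rewrite ZE /twist; ring.
apply: (qsubN XQ); apply: (qsub_sum XQ) => i _ _.
have li : (i.+1 < size l)%N by rewrite sl ltnS ltn_ord.
have tZ : Z (wt (take i.+1 l)) (Zs (rev (take i.+1 l))).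
  by rewrite -wt_rev; apply: Zs_in_Z.
rewrite /twist mulrCA; apply: (qsub_sign XQ); apply: (XM _ _ _ _ _ _ _ tZ (Zs_in_Z _)).
- by rewrite wt_gt0 E.
- by rewrite wt_gt0 -size_eq0 size_drop subn_eq0 -ltnNge.
- by rewrite -wt_cat cat_take_drop.
Qed.

Lemma Z_ZFspan k d : Z k d -> ZFspan Zs k d.
Proof.
elim/ltn_ind: k d => k IH d.
have XQ : qsubspace (ZFspan Zs k) by apply: Qspan_sub.
have XM i j p q : (0 < i)%N -> (0 < j)%N -> (i + j)%N = k ->
    Z i p -> Z j q -> ZFspan Zs k (p * q).
  apply: (products_in_span (Z := Z) (Zst := Zst R)) => //.
  - exact: Z_sub.
  - exact: Z0_1.
  - exact: Z_mul.
  - exact: Zst_hom.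
  - exact: Zst_letter.
  - by move=> v v0; rewrite Zst_conv ?Zs_conv.
  - exact: Zs_stuffle.
  - exact: Zs_nil.
  - exact: Zs_ones.
  - exact: Zst_in_Z.
apply: (Z_ind XQ) => r r0 rk; rewrite -Zs_conv //.
(* Weight 0 is separate because [cyclic_mod] treats words of length n+1; the only value there is
   1. *)
case: k rk {IH} XQ XM => [|n] rk XQ XM.
  have -> : r = [::] by case: r {r0} rk => // a r; rewrite wt_cons.
  have := ZF_in_span Zs [::].
  by rewrite /ZF /conv big_ord1 /twist /= Zs_nil !mul1r.
rewrite -[Zs r]word_value_valid ?valid_enc //.
have gM u v : u != [::] -> v != [::] -> (size u + size v)%N = n.+1 ->
    ZFspan Zs n.+1 (word_value u * word_value v).
  rewrite -!size_eq0 -!lt0n => u0 v0 uv.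
  by apply: (XM _ _ _ _ u0 v0 uv); apply: word_value_Z.
apply: (cyclic_mod XQ word_value_hom gM word_value_dual word_value_true) => [w wn|]; last by rewrite size_enc.
have vW : valid (rcons (rev w) true) by rewrite /valid last_rcons.
have [l E] := enc_onto vW.
have lk : wt l = n.+1 by rewrite -size_enc -E size_rcons size_rev wn.
have l0 : l != [::] by rewrite -wt_gt0 lk.
have E' : enc (rev l) = rcons w true.
  by have := rcons_rev_enc l; rewrite -E rev_rcons revK rcons_cons => -[].
have H1 : ZFspan Zs n.+1 (Zs (rev l) + (-1) ^+ wt l * Zs l).
  by apply: ZF_ends => //; [rewrite lk; apply: XM|rewrite -lk; apply: ZF_in_span].
have H2 : ZFspan Zs n.+1 (word_value (rcons (rev w) true) + (-1) ^+ n.+1 * word_value (true :: w)).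
  have := antipode_mod XQ word_value_hom gM (w := rcons (rev w) true).
  by rewrite rev_rcons revK; apply; rewrite size_rcons size_rev wn.
(* The finite value relates g(w y) to g(rev(w) y), and the antipode relates g(rev(w) y) to g(y w).
   Subtracting with the sign (-1)^(n+1) eliminates the middle word. *)
have -> : word_value (rcons w true) - word_value (true :: w) =
   (Zs (rev l) + (-1) ^+ wt l * Zs l) -
   (-1) ^+ n.+1 * (word_value (rcons (rev w) true) + (-1) ^+ n.+1 * word_value (true :: w)).
  rewrite mulrDr mulrA -expr2 sqrr_sign mul1r lk.
  rewrite /Zs E' -E -!word_value_valid ?valid_enc //; last by rewrite /valid last_rcons.
  by ring.
by apply: (qsubB XQ) => //; apply: qsub_sign.
Qed.

End Main.

Theorem theorem6p4 (R : realType) (k : nat) :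
  Z_F_sh_space R k = Z_space R k.
Proof.
rewrite Z_F_ZFspan; apply/seteqP; split=> d; last exact: Z_ZFspan.
apply: Qspan_min; first exact: Z_sub.
move=> _ [l /= <- <-]; apply: (ZF_Z (Zst := Zst R)).
- exact: Z_sub.
- exact: Z0_1.
- exact: Z_mul.
- exact: Zst_hom.
- by move=> v v0; rewrite Zst_conv ?Zs_conv.
- exact: Zs_stuffle.
- exact: Zs_nil.
- exact: Zs_ones.
- exact: Zst_in_Z.
Qed.
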